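(* For any positive integer $d$ and any non-negative integer $m$, $$\zeta^{\star}(\{\{2\}^{m},3,\{2\}^{m},1\}^d)=4^{m+1}\pi^{4d(m+1)}\sum_{\substack{n_0,\ldots,n_m\ge 0\\ n_0+\cdots+n_m=2(m+1)d}}\exp\left(\frac{2\pi i}{m+1}\sum_{k=0}^{m}kn_k\right)\prod_{k=0}^{m}\left(\sum_{l_k=0}^{n_k}(4^{l_k+1}-1)\frac{B_{2l_k+2}}{(2l_k+2)!}\frac{B_{2n_k-2l_k}}{(2n_k-2l_k)!}\,e^{\frac{\pi i l_k}{m+1}}\right)$$ and $$\zeta^{\star}(\{\{2\}^{m},3,\{2\}^{m},1\}^d,\{2\}^{m+1})=(-1)^m4^{m+1}\pi^{(4d+2)(m+1)}\sum_{\substack{n_0,\ldots,n_m\ge 0\\ n_0+\cdots+n_m=(m+1)(2d+1)}}\exp\left(\frac{2\pi i}{m+1}\sum_{k=0}^{m}kn_k\right)\prod_{k=0}^{m}\left(\sum_{l_k=0}^{n_k}(4^{l_k+1}-1)\frac{B_{2l_k+2}}{(2l_k+2)!}\frac{B_{2n_k-2l_k}}{(2n_k-2l_k)!}\,e^{\frac{\pi i l_k}{m+1}}\right),$$ where the outer sums run over tuples of non-negative integers $(n_0,\ldots,n_m)$.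
   Context: Here $i=\sqrt{-1}$. For positive integers $s_1,\ldots,s_r$ with $s_1>1$, the multiple zeta star value is $\zeta^\star(s_1,\ldots,s_r)=\sum_{k_1\ge\cdots\ge k_r\ge 1}\frac{1}{k_1^{s_1}\cdots k_r^{s_r}}$ (sum over positive integers). The notation $\{a_1,\ldots,a_k\}^d$ means $d$ successive repetitions of the sequence $a_1,\ldots,a_k$; in particular $\{\{2\}^m,3,\{2\}^m,1\}^d$ is $d$ repetitions of the sequence consisting of $m$ twos, a $3$, $m$ twos, and a $1$. The Bernoulli numbers $B_s$ are defined by $\frac{t}{e^t-1}=\sum_{s=0}^\infty B_s\frac{t^s}{s!}$. *)

(* Defs.v *)
From HB Require Import structures.
From mathcomp Require Import all_boot all_order all_algebra.
From mathcomp Require Import all_classical all_reals all_analysis.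
From mathcomp Require Import complex.

Set Implicit Arguments.
Unset Strict Implicit.
Unset Printing Implicit Defensive.

Import Order.TTheory GRing.Theory Num.Theory.
Import numFieldNormedType.Exports.

Local Open Scope classical_set_scope.
Local Open Scope ring_scope.
Local Open Scope complex_scope.

Definition cexp (R : realType) (z : R[i]) : R[i] :=
  (expR (complex.Re z))%:C *
  (cos (complex.Im z) +i* sin (complex.Im z)).

(* The value at t = 0 of t / (expR t - 1) is a junk value, whence the punctured
   neighbourhood.  At most one sequence satisfies the predicate, since the
   coefficients of a power series are determined by its values near 0. *)
Definition is_bernoulli (R : realType) (B : nat -> R) : Prop :=
  \forall t \near (0 : R)^',
    series (fun s : nat => B s * (t ^+ s / s`!%:R)) n @[n --> \oo]
      --> t / (expR t - 1).

Definition mzsv_index (r : nat) : set (r.-tuple nat) :=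
  [set k | sorted geq k && all (leq 1) k].

(* The terms are nonnegative, so the unordered sum always makes sense in
   [0, +oo]; it is finite when the first entry of s exceeds 1. *)
Definition mzsv (R : realType) (s : seq nat) : \bar R :=
  \esum_(k in @mzsv_index (size s))
    ((\prod_(j < size s) ((tnth k j)%:R ^+ nth 0%N s j))^-1)%:E.

Definition repeat_seq (d : nat) (a : seq nat) : seq nat := flatten (nseq d a).

Definition block (m : nat) : seq nat :=
  nseq m 2%N ++ [:: 3%N] ++ nseq m 2%N ++ [:: 1%N].

Definition bernoulli_factor (R : realType) (B : nat -> R) (m n : nat) : R[i] :=
  \sum_(l < n.+1)
    ((4%:R ^+ l.+1 - 1) * (B (2 * l + 2)%N / (2 * l + 2)`!%:R)
       * (B (2 * n - 2 * l)%N / (2 * n - 2 * l)`!%:R))%:C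
    * cexp (pi%:C * 'i * l%:R / m.+1%:R).

(* The sum over the tuples (n_0, ..., n_m) of naturals of total N; each entry of
   such a tuple is at most N, so they may be taken in 'I_N.+1. *)
Definition bernoulli_sum (R : realType) (B : nat -> R) (m N : nat) : R[i] :=
  \sum_(n : {ffun 'I_m.+1 -> 'I_N.+1} | (\sum_k n k == N)%N)
    cexp (2%:R * pi%:C * 'i / m.+1%:R * (\sum_(k < m.+1) k * n k)%N%:R)
    * \prod_(k < m.+1) bernoulli_factor B m (n k).

(* Main.v *)
Require Import Defs.
From HB Require Import structures.
From mathcomp Require Import all_boot all_order all_algebra.
From mathcomp Require Import all_classical all_reals all_analysis.
From mathcomp Require Import complex.
From mathcomp Require Import ring lra zify.

Set Implicit Arguments.
Unset Strict Implicit.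
Unset Printing Implicit Defensive.

Import Order.TTheory GRing.Theory Num.Theory.
Import numFieldNormedType.Exports.

Local Open Scope classical_set_scope.
Local Open Scope ring_scope.
Local Open Scope complex_scope.

(** Write y_k = (-1)^(k-1) / k^(2m+2). The theorem rests on the identity

      sum_D Z_D X^D = prod_(k >= 1) (1 + y_k X) / (1 - y_k X),

    where Z_D is the star value of d blocks for D = 2d, and of d blocks followed
    by m + 1 twos for D = 2d + 1.

    Left side. Let c(n, k) = binom(2n, n+k) / binom(2n, n). Prepending an entry
    s to an index acts on truncated star sums by f |-> sum_(j <= n) f(j) / j^s.
    The functions c(-, k) with k >= 1 are eigenvectors for s = 2, with
    eigenvalue 1 / k^2 ([star_expansion2]); the entries 1 and 3 act by simple
    triangular matrices, because multiplication by n is bidiagonal on the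
    c(n, k) ([cbin_abel]). Together, the entries of a block take the sequence of
    increments in k of the coefficient of X^D in the partial products to the same
    sequence for X^(D+2) ([star_expansion_block]). Hence a truncated star sum is
    the sum over k of c(n, k) times the k-th increment of a coefficient of the
    partial products, and c(n, k) -> 1 boundedly as n grows
    ([cvg_star_expansion]).

    Right side. Put X = - t^(m+1), let omega be a primitive root of unity of
    order m + 1 and zeta one of its square roots with zeta^(m+1) = -1. Then
    1 -+ t^(m+1) / k^(2m+2) is the product over j of 1 - omega^j t / k^2, resp.
    of 1 - zeta omega^j t / k^2, so the product over k becomes a product over j
    of quotients of S(t) = prod_k (1 - t / k^2) and of S(t / 4), which collects
    the even k ([rot_star_fps]). By Euler's product for the sine
    ([cvg_sin_prod]) S(t) = sin(x) / x with x = pi sqrt t, and the quotients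
    S(t) / S(t/4)^2 and S(t/4)^2 / S(t) are (x/2) cot(x/2) and
    tan(x/2) / (x/2), whose coefficients are given by the Bernoulli numbers
    ([sinhc_bern_even], [sinhc_bern_tanh]). Comparing the coefficients of
    t^((m+1) D) gives the formula ([star_limit_coef]).

    All this is done with formal power series whose coefficients converge one by
    one, so that no complex analysis is involved. Besides these limits, real
    analysis enters twice: in the moments of x^(2l) against cos^(2n), which prove
    Euler's product, and in the passage from the definition of the Bernoulli
    numbers by a convergent series to an identity of formal series
    ([bernoulli_mul_expR1]). *)

(** * Formal power series *)

(** The wrapper keeps the Cauchy product apart from the pointwise product of
functions. *)
Record fps (K : Type) := Fps { fcoef : nat -> K }.

Notation "f .%[ n ]" := (fcoef f n) (at level 2, n at level 200, format "f .%[ n ]").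

Section FpsRing.
Variable K : comNzRingType.

HB.instance Definition _ := gen_eqMixin (fps K).
HB.instance Definition _ := gen_choiceMixin (fps K).

Implicit Types f g h : fps K.

Lemma fpsP f g : (forall n, f.%[n] = g.%[n]) -> f = g.
Proof. by case: f g => f [g] /= /funext ->. Qed.

Definition fps_trunc N f : {poly K} := \poly_(i < N) f.%[i].

Definition fps_zero : fps K := Fps (fun=> 0).
Definition fps_opp f : fps K := Fps (fun n => - f.%[n]).
Definition fps_add f g : fps K := Fps (fun n => f.%[n] + g.%[n]).
Definition fps_one : fps K := Fps (fun n => (n == 0)%:R).
Definition fps_mul f g : fps K := Fps (fun n => \sum_(i < n.+1) f.%[i] * g.%[n - i]).

Lemma fps_addA : associative fps_add.
Proof. by move=> f g h; apply: fpsP => n /=; rewrite addrA. Qed.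
Lemma fps_addC : commutative fps_add.
Proof. by move=> f g; apply: fpsP => n /=; rewrite addrC. Qed.
Lemma fps_add0 : left_id fps_zero fps_add.
Proof. by move=> f; apply: fpsP => n /=; rewrite add0r. Qed.
Lemma fps_addN : left_inverse fps_zero fps_opp fps_add.
Proof. by move=> f; apply: fpsP => n /=; rewrite addNr. Qed.

HB.instance Definition _ := GRing.isZmodule.Build (fps K)
  fps_addA fps_addC fps_add0 fps_addN.

Lemma coef_fps_trunc N f n : (n < N)%N -> (fps_trunc N f)`_n = f.%[n].
Proof. by move=> nN; rewrite coef_poly nN. Qed.

(** Only the coefficients up to [n] matter for the coefficient of degree [n] of
a product. This brings the ring axioms back to those of polynomials. *)
Lemma coefM_agree (p q : {poly K}) f g n :
  (forall i, (i <= n)%N -> p`_i = f.%[i]) ->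
  (forall i, (i <= n)%N -> q`_i = g.%[i]) ->
  (p * q)`_n = (fps_mul f g).%[n].
Proof.
move=> pf qg; rewrite coefM; apply: eq_bigr => i _.
by rewrite pf ?qg ?leq_subr // -ltnS.
Qed.

Lemma fps_trunc_agree N f n : (n < N)%N ->
  forall i, (i <= n)%N -> (fps_trunc N f)`_i = f.%[i].
Proof. by move=> nN i ni; rewrite coef_fps_trunc // (leq_ltn_trans ni). Qed.

Lemma fps_mulA : associative fps_mul.
Proof.
move=> f g h; apply: fpsP => n.
pose t := fps_trunc n.+1.
have agM (u v : fps K) i : (i <= n)%N -> (t u * t v)`_i = (fps_mul u v).%[i].
  move=> ni; apply: coefM_agree => j ji; apply: (@fps_trunc_agree _ _ i) => //.
rewrite -(@coefM_agree (t f) (t g * t h)); last exact: agM.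
  rewrite -(@coefM_agree (t f * t g) (t h)) ?mulrA //; first exact: agM.
  exact: fps_trunc_agree.
exact: fps_trunc_agree.
Qed.

Lemma fps_mulC : commutative fps_mul.
Proof.
move=> f g; apply: fpsP => n; have tP u := @fps_trunc_agree n.+1 u n (ltnSn n).
by rewrite -(coefM_agree (tP f) (tP g)) mulrC (coefM_agree (tP g) (tP f)).
Qed.

Lemma fps_mul1 : left_id fps_one fps_mul.
Proof.
move=> f; apply: fpsP => n /=; rewrite big_ord_recl /= subn0 mul1r.
by rewrite big1 ?addr0 // => i _; rewrite mul0r.
Qed.

Lemma fps_mulDl : left_distributive fps_mul fps_add.
Proof.
move=> f g h; apply: fpsP => n /=; rewrite -big_split /=.
by apply: eq_bigr => i _; rewrite mulrDl.
Qed.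

Lemma fps_oner_neq0 : fps_one != fps_zero.
Proof.
by apply/eqP => /(congr1 (fun f => f.%[0])) /= /eqP; rewrite oner_eq0.
Qed.

HB.instance Definition _ := GRing.Zmodule_isComNzRing.Build (fps K)
  fps_mulA fps_mulC fps_mul1 fps_mulDl fps_oner_neq0.

Lemma fcoef1 n : (1 : fps K).%[n] = (n == 0)%:R. Proof. by []. Qed.
Lemma fcoefD f g n : (f + g).%[n] = f.%[n] + g.%[n]. Proof. by []. Qed.
Lemma fcoefN f n : (- f).%[n] = - f.%[n]. Proof. by []. Qed.
Lemma fcoefB f g n : (f - g).%[n] = f.%[n] - g.%[n]. Proof. by []. Qed.
Lemma fcoefM f g n : (f * g).%[n] = \sum_(i < n.+1) f.%[i] * g.%[n - i].
Proof. by []. Qed.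
Lemma fcoefMn f k n : (f *+ k).%[n] = f.%[n] *+ k.
Proof. by elim: k => //= k IH; rewrite !mulrS fcoefD IH. Qed.

Definition fpsX : fps K := Fps (fun n => (n == 1)%:R).
Definition fpsC (c : K) : fps K := Fps (fun n => if n == 0 then c else 0).

Lemma fcoefXM f n : (fpsX * f).%[n] = if n is k.+1 then f.%[k] else 0.
Proof.
rewrite fcoefM; case: n => [|n]; first by rewrite big_ord1 mul0r.
rewrite 2!big_ord_recl /= mul0r add0r mul1r subSS subn0 big1 ?addr0 // => i _.
by rewrite mul0r.
Qed.

Lemma fcoefCM c f n : (fpsC c * f).%[n] = c * f.%[n].
Proof.
by rewrite fcoefM big_ord_recl /= subn0 big1 ?addr0 // => i _; rewrite mul0r.
Qed.

Lemma fpsX_inj f g : fpsX * f = fpsX * g -> f = g.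
Proof.
move=> E; apply: fpsP => n.
by have := congr1 (fun h => h.%[n.+1]) E; rewrite !fcoefXM.
Qed.

Lemma fcoef_prod0 (I : Type) (r : seq I) (P : pred I) (F : I -> fps K) :
  (\prod_(i <- r | P i) F i).%[0] = \prod_(i <- r | P i) (F i).%[0].
Proof.
elim/big_ind2: _ => [//|f a g b fa gb|//].
by rewrite fcoefM big_ord1 /= fa gb.
Qed.

(** A series of constant coefficient 1 is regular, since the coefficients of a
quotient are determined one after the other. *)
Lemma fps_mulI f g h : f.%[0] = 1 -> f * g = f * h -> g = h.
Proof.
move=> f0 E; apply: fpsP; elim/ltn_ind => n IH.
have := congr1 (fun h => h.%[n]) E; rewrite !fcoefM !big_ord_recl /= !subn0 f0.
rewrite !mul1r (eq_bigr (fun i : 'I_n => f.%[lift ord0 i] * h.%[n - lift ord0 i])).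
  exact: addIr.
by move=> i _; rewrite IH // ltn_subrL /= (leq_ltn_trans _ (ltn_ord i)).
Qed.

(** Expansion of a finite product of series; exponents bounded by [N] suffice
for the coefficient of degree [N]. *)
Lemma fcoef_prod n (F : 'I_n -> fps K) N :
  (\prod_i F i).%[N] =
  \sum_(e : {ffun 'I_n -> 'I_N.+1} | (\sum_k e k == N)%N) \prod_k (F k).%[e k].
Proof.
have -> : (\prod_i F i).%[N] = (\prod_i fps_trunc N.+1 (F i))`_N.
  suff H k : (k <= N)%N ->
      (\prod_i F i).%[k] = (\prod_i fps_trunc N.+1 (F i))`_k by exact: H.
  elim/big_ind2: _ k => [k _|p f q g pf qg k kN|i _ k kN].
  - by rewrite coef1.
  - rewrite -(@coefM_agree p q f g) // => i ik.
      by rewrite pf // (leq_trans ik).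
    by rewrite qg // (leq_trans ik).
  - by rewrite coef_fps_trunc.
rewrite (eq_bigr (fun i => \sum_(j < N.+1) ((F i).%[j] *: 'X^j))); last first.
  by move=> i _; rewrite /fps_trunc poly_def.
rewrite bigA_distr_bigA coef_sum [RHS]big_mkcond /=; apply: eq_bigr => e _.
have -> : \prod_i ((F i).%[e i] *: 'X^(e i)) =
          (\prod_k (F k).%[e k]) *: 'X^(\sum_k e k) :> {poly K}.
  rewrite scaler_prod; congr (_ *: _).
  by elim/big_rec2: _ => [//|i a p _ ->]; rewrite exprD.
by rewrite coefZ coefXn eq_sym; case: eqP; rewrite ?mulr1 ?mulr0.
Qed.

(** Substitution [X := c X]. *)
Definition scl (c : K) f : fps K := Fps (fun n => c ^+ n * f.%[n]).

Lemma scl_is_additive c : additive (scl c).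
Proof. by move=> f g; apply: fpsP => n /=; rewrite mulrBr. Qed.
Lemma scl_is_multiplicative c : multiplicative (scl c).
Proof.
split=> [f g|]; apply: fpsP => n /=.
  rewrite mulr_sumr; apply: eq_bigr => i _.
  by rewrite mulrACA -exprD subnKC // -ltnS.
by case: n => [|n]; rewrite ?mul1r ?mulr0.
Qed.
HB.instance Definition _ c :=
  GRing.isAdditive.Build (fps K) (fps K) (scl c) (scl_is_additive c).
HB.instance Definition _ c :=
  GRing.isMultiplicative.Build (fps K) (fps K) (scl c) (scl_is_multiplicative c).

Lemma scl_scl c d f : scl c (scl d f) = scl (c * d) f.
Proof. by apply: fpsP => n /=; rewrite mulrA exprMn. Qed.

Lemma sclC c a : scl c (fpsC a) = fpsC a.
Proof. by apply: fpsP => -[|n] /=; rewrite ?mul1r ?mulr0. Qed.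
Lemma sclX c : scl c fpsX = fpsC c * fpsX.
Proof.
apply: fpsP => n; rewrite fcoefCM /=.
by case: n => [|[|n]] /=; rewrite ?mulr0.
Qed.

Lemma fpsC_opp (a : K) : fpsC (- a) = - fpsC a.
Proof. by apply: fpsP => -[|n] //=; rewrite oppr0. Qed.

Lemma scl_monom (c a : K) : scl c (fpsC a * fpsX) = fpsC (c * a) * fpsX.
Proof.
rewrite rmorphM /= sclC sclX.
by apply: fpsP => j; rewrite !fcoefCM mulrCA mulrA.
Qed.

(** Substitution [X := X ^ k.+1]. *)
Definition dil k f : fps K :=
  Fps (fun n => if (k.+1 %| n)%N then f.%[n %/ k.+1] else 0).

Lemma dil_coef k f n : (dil k f).%[n * k.+1] = f.%[n].
Proof. by rewrite /= dvdn_mull // mulnK. Qed.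

Lemma dil_inj k : injective (dil k).
Proof.
move=> f g E; apply: fpsP => n.
by have := congr1 (fun h => h.%[n * k.+1]) E; rewrite !dil_coef.
Qed.

Lemma dil_is_additive k : additive (dil k).
Proof. by move=> f g; apply: fpsP => n /=; case: ifP; rewrite ?subr0. Qed.
(** By truncation this reduces to the composition of polynomials. *)
Lemma dil_is_multiplicative k : multiplicative (dil k).
Proof.
have tP u n := @fps_trunc_agree n.+1 u n (ltnSn n).
have dP u n i : (i <= n)%N ->
    (fps_trunc n.+1 u \Po 'X^(k.+1))`_i = (dil k u).%[i].
  move=> ni; rewrite coef_comp_poly_Xn //=; case: ifP => // _.
  by rewrite (tP u n) // (leq_trans (leq_div _ _)).
split=> [f g|]; apply: fpsP => n; last first.
  rewrite /=; case: ifP => [/dvdnP[q ->]|]; last by case: n.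
  by rewrite mulnK // muln_eq0 orbF.
rewrite -(coefM_agree (dP f n) (dP g n)) -comp_polyM coef_comp_poly_Xn //=.
case: ifP => // _.
rewrite [RHS](@coefM_agree (fps_trunc n.+1 f) (fps_trunc n.+1 g) f g) //.
  by move=> i ik; rewrite (tP f n) // (leq_trans ik) // leq_div.
by move=> i ik; rewrite (tP g n) // (leq_trans ik) // leq_div.
Qed.
HB.instance Definition _ k :=
  GRing.isAdditive.Build (fps K) (fps K) (dil k) (dil_is_additive k).
HB.instance Definition _ k :=
  GRing.isMultiplicative.Build (fps K) (fps K) (dil k) (dil_is_multiplicative k).

End FpsRing.
Arguments fpsX {K}.

Definition fps_map (K L : comNzRingType) (phi : {rmorphism K -> L})
  (f : fps K) : fps L := Fps (fun n => phi f.%[n]).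

Section FpsMap.
Variables (K L : comNzRingType) (phi : {rmorphism K -> L}).

Lemma fps_map_is_additive : additive (fps_map phi).
Proof. by move=> f g; apply: fpsP => n /=; rewrite rmorphB. Qed.
Lemma fps_map_is_multiplicative : multiplicative (fps_map phi).
Proof.
split=> [f g|]; apply: fpsP => n /=; last by rewrite rmorph_nat.
by rewrite rmorph_sum; apply: eq_bigr => i _; rewrite rmorphM.
Qed.
HB.instance Definition _ :=
  GRing.isAdditive.Build (fps K) (fps L) (fps_map phi) fps_map_is_additive.
HB.instance Definition _ :=
  GRing.isMultiplicative.Build (fps K) (fps L) (fps_map phi)
    fps_map_is_multiplicative.

Lemma fps_map_monom a : fps_map phi (fpsC a * fpsX) = fpsC (phi a) * fpsX.
Proof.
apply: fpsP => n; rewrite fcoefCM -[LHS]/(phi (fpsC a * fpsX).%[n]).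
by rewrite fcoefCM rmorphM /= rmorph_nat.
Qed.

End FpsMap.

(** * The series of coth and tanh, by Bernoulli numbers *)

Section BernoulliAlgebra.
Variable R : realType.

Definition fps_expR : fps R := Fps (fun n => n`!%:R^-1).

(** The series of (exp X - 1) / X. *)
Definition fps_expR1 : fps R := Fps (fun n => (n.+1)`!%:R^-1).

(** The series of sinh(sqrt t) / sqrt t in t. *)
Definition sinhc : fps R := Fps (fun l => (2 * l + 1)`!%:R^-1).

Lemma fps_expR1E : fpsX * fps_expR1 = fps_expR - 1.
Proof.
apply: fpsP => n; rewrite fcoefXM fcoefB fcoef1.
by case: n => [|n] /=; rewrite ?fact0 ?invr1 ?subrr ?subr0.
Qed.

Lemma scl_expR_mul (c d : R) :
  scl c fps_expR * scl d fps_expR = scl (c + d) fps_expR.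
Proof.
apply: fpsP => n; rewrite fcoefM /= addrC exprDn mulr_suml.
apply: eq_bigr => i _.
have ni : (i <= n)%N by rewrite -ltnS.
have fu k : k`!%:R != 0 :> R by rewrite pnatr_eq0 -lt0n fact_gt0.
rewrite -(bin_fact ni) !natrM -mulr_natr.
have := fu i; have := fu (n - i)%N.
have : 'C(n, i)%:R != 0 :> R by rewrite pnatr_eq0 -lt0n bin_gt0.
set x := 'C(n, i)%:R; set y := i`!%:R; set z := (n - i)`!%:R => x0 z0 y0.
by field; rewrite x0 y0 z0.
Qed.

Lemma scl_expR0 : scl 0 fps_expR = 1.
Proof.
by apply: fpsP => -[|n]; rewrite fcoef1 /= ?expr0 ?fact0 ?invr1 ?mul1r ?expr0n ?mul0r.
Qed.

Lemma fps_mul2I (f g : fps R) : 2 * f = 2 * g -> f = g.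
Proof.
move=> E; apply: fpsP => n; have := congr1 (fun h => h.%[n]) E.
by rewrite !mulr_natl !fcoefMn => /eqP; rewrite -subr_eq0 -mulrnBl mulrn_eq0 /= subr_eq0 => /eqP.
Qed.

Lemma sinhcE : 2 * (fpsX * dil 1 sinhc) = fps_expR - scl (-1) fps_expR.
Proof.
apply: fpsP => n; rewrite mulr_natl fcoefMn fcoefXM fcoefB /=.
case: n => [|n] /=; first by rewrite fact0 invr1 mul1r subrr mul0rn.
rewrite dvdn2 exprS -signr_odd; case: (boolP (odd n)) => /= on.
  by rewrite mulN1r opprK mul1r subrr mul0rn.
rewrite mulN1r mulN1r opprK mulr2n; congr (_ + _); congr (_ ^-1); congr (_%:R).
all: by rewrite addn1 divn2 mul2n even_halfK.
Qed.

Variable B : nat -> R.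

(** For the Bernoulli numbers, the series of (sqrt t / 2) coth (sqrt t / 2). *)
Definition bern_even : fps R := Fps (fun l => B (2 * l)%N / (2 * l)`!%:R).

(** For the Bernoulli numbers, the series of tanh (sqrt t / 2) / (sqrt t / 2). *)
Definition bern_tanh : fps R :=
  Fps (fun l => 4 * ((4 ^+ l.+1 - 1) * (B (2 * l + 2)%N / (2 * l + 2)`!%:R))).

Definition bern_all : fps R := Fps (fun n => B n / n`!%:R).

Lemma bern_evenE : 2 * dil 1 bern_even = bern_all + scl (-1) bern_all.
Proof.
apply: fpsP => n; rewrite mulr_natl fcoefMn fcoefD /=.
rewrite dvdn2 -signr_odd; case: (boolP (odd n)) => /= on.
  by rewrite mulN1r subrr mul0rn.
by rewrite mul1r mulr2n divn2 mul2n even_halfK.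
Qed.

Lemma bern_tanhE :
  fpsX * (fpsX * dil 1 bern_tanh) =
  4 * (scl 2 (dil 1 bern_even) - dil 1 bern_even).
Proof.
apply: fpsP => n; rewrite mulr_natl fcoefMn fcoefB fcoefXM.
case: n => [|n]; last (rewrite fcoefXM; case: n => [|n]); rewrite /=.
- by rewrite div0n expr0 mul1r subrr mul0rn.
- by rewrite mulr0 subrr mul0rn.
- rewrite !dvdn2 /= negbK; case: (boolP (odd n)) => /= on.
    by rewrite mulr0 subrr mul0rn.
  have -> : (n.+2 %/ 2 = (n %/ 2).+1)%N by lia.
  have E : (2 * (n %/ 2).+1 = n.+2)%N.
    by rewrite divn2 mulnS mul2n even_halfK.
  have E' : (2 * (n %/ 2) + 2 = n.+2)%N by rewrite -E mulnS addnC.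
  have -> : (2 : R) ^+ n.+2 = 4 ^+ (n %/ 2).+1 by rewrite -[in LHS]E exprM -natrX.
  by rewrite E E' -[RHS]mulr_natl mulrBl mul1r.
Qed.

Hypothesis bernM : bern_all * fps_expR1 = 1.

Let a := scl 2^-1 fps_expR.
Let a' := scl (- 2^-1) fps_expR.

Let half2 : 2^-1 + 2^-1 = 1 :> R. Proof. by lra. Qed.

Let aa' : a * a' = 1.
Proof. by rewrite scl_expR_mul subrr scl_expR0. Qed.

Let aa : a * a = fps_expR.
Proof.
rewrite scl_expR_mul half2; apply: fpsP => n /=.
by rewrite expr1n mul1r.
Qed.

Let a'a' : a' * a' = scl (-1) fps_expR.
Proof. by rewrite scl_expR_mul -opprD half2. Qed.

Let sinhc_half : fpsX * dil 1 (scl 4^-1 sinhc) = a - a'.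
Proof.
have -> : dil 1 (scl 4^-1 sinhc) = scl 2^-1 (dil 1 sinhc).
  apply: fpsP => n /=; case: ifP => [/dvdnP[k ->]|]; last by rewrite mulr0.
  have -> : 4^-1 = 2^-1 ^+ 2 :> R by rewrite exprVn -natrX.
  by rewrite mulnK // -exprM mulnC.
have : scl 2^-1 (2 * (fpsX * dil 1 sinhc)) = a - a'.
  by rewrite sinhcE rmorphB /= scl_scl mulrN1.
move <-; rewrite !rmorphM rmorph_nat /= sclX; apply: fpsP => n.
by rewrite mulr_natl fcoefMn -mulrA fcoefCM -mulrnAl -[2^-1 *+ 2]mulr_natr mulVf ?mul1r // pnatr_eq0.
Qed.

Let sinhc_aa : 2 * (fpsX * dil 1 sinhc) = (a - a') * (a + a').
Proof. by rewrite sinhcE -a'a' -aa; ring. Qed.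

Let coth_id : 2 * dil 1 bern_even * (a - a') = fpsX * (a + a').
Proof.
have E1 : bern_all * (fps_expR - 1) = fpsX.
  by rewrite -fps_expR1E mulrCA bernM mulr1.
have E2 : scl (-1) bern_all * (1 - scl (-1) fps_expR) = fpsX.
  have := congr1 (scl (-1)) E1; rewrite rmorphM rmorphB rmorph1 /= sclX.
  have -> : fpsC (-1) * fpsX = - fpsX :> fps R.
    by apply: fpsP => n; rewrite fcoefCM fcoefN mulN1r.
  by move=> E; apply: oppr_inj; rewrite -E; ring.
have E3 : bern_all * (a - a') = a' * fpsX.
  have <- : bern_all * (a * a - a * a') = fpsX by rewrite aa aa'.
  transitivity (bern_all * (a - a') * (a * a')); first by rewrite aa' mulr1.
  ring.
have E4 : scl (-1) bern_all * (a - a') = a * fpsX.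
  have <- : scl (-1) bern_all * (a * a' - a' * a') = fpsX by rewrite a'a' aa'.
  transitivity (scl (-1) bern_all * (a - a') * (a * a')).
    by rewrite aa' mulr1.
  ring.
by rewrite bern_evenE mulrDl E3 E4; ring.
Qed.

(** The identity sinh x / x = (sinh (x/2) / (x/2))^2 (x/2) coth (x/2), where
x^2 is the variable of the three series. *)
Lemma sinhc_bern_even : sinhc = scl 4^-1 sinhc ^+ 2 * bern_even.
Proof.
apply: (@dil_inj _ 1); rewrite rmorphM rmorphXn /=.
apply/fpsX_inj/fpsX_inj/fps_mul2I.
have sh := sinhc_half; set s := dil 1 (scl 4^-1 sinhc) in sh *.
have ch := coth_id.
set G := dil 1 bern_even in ch *.
transitivity (fpsX * (2 * (fpsX * dil 1 sinhc))); first by ring.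
rewrite sinhc_aa.
transitivity ((a - a') * (fpsX * (a + a'))); first by ring.
by rewrite -ch -sh; ring.
Qed.

(** This is sinh (x/2)^2 / (x/2)^2 = (sinh x / x) tanh (x/2) / (x/2). The series
of tanh comes from (x/2) tanh (x/2) = x coth x - (x/2) coth (x/2), which is
where the factors 4^(l+1) - 1 originate. *)
Lemma sinhc_bern_tanh : scl 4^-1 sinhc ^+ 2 = sinhc * bern_tanh.
Proof.
apply: (@dil_inj _ 1); rewrite [RHS]rmorphM [LHS]rmorphXn /=.
have sh := sinhc_half; set s := dil 1 (scl 4^-1 sinhc) in sh *.
have ch := coth_id.
have coth_id2 : 2 * scl 2 (dil 1 bern_even) * (a * a - a' * a') =
    2 * fpsX * (a * a + a' * a').
  have := congr1 (scl 2) coth_id.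
  rewrite !rmorphM rmorph_nat rmorphB rmorphD /= sclX !scl_scl => E.
  rewrite aa a'a'; move: E; rewrite mulrN mulfV ?pnatr_eq0 //.
  have -> : scl 1 fps_expR = fps_expR.
    by apply: fpsP => n /=; rewrite expr1n mul1r.
  move->; congr (_ * _ * _).
  by apply: fpsP => -[|n]; rewrite [RHS]fcoefMn fcoef1 //= mul0rn.
apply/fpsX_inj/fpsX_inj/fpsX_inj/fps_mul2I/fps_mul2I.
set W := dil 1 bern_tanh.
have WE := bern_tanhE; rewrite -/W in WE.
transitivity (4 * fpsX * (fpsX * s) ^+ 2); first by ring.
transitivity ((fpsX * (fpsX * W)) * (2 * (2 * (fpsX * dil 1 sinhc)))); last by ring.
rewrite sh sinhc_aa WE.
set G := dil 1 bern_even in ch coth_id2 *; set G2 := scl 2 G in coth_id2 *.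
transitivity (4 * (2 * G2 * (a * a - a' * a')
                   - (2 * G * (a - a')) * (a + a'))); last by ring.
by rewrite ch coth_id2; ring.
Qed.

End BernoulliAlgebra.

(** * From convergent series to formal series *)

Section AsymptoticExpansion.
Variable R : realType.

(** Asymptotic expansions at 0 multiply by comparing finitely many coefficients,
so they transfer identities of functions to formal series without a theorem on
products of convergent series. *)
Definition expands (f : R -> R) (a : fps R) : Prop :=
  forall n, exists C r : R, 0 < r /\
    forall t, 0 < `|t| -> `|t| < r ->
      `|f t - (fps_trunc n a).[t]| <= C * `|t| ^+ n.

Lemma expands_ext f g a :
  (forall t, t != 0 -> f t = g t) -> expands f a -> expands g a.
Proof.
move=> fg fa n; have [C [r [r0 H]]] := fa n; exists C, r; split=> // t t0 tr.
by rewrite -fg ?H // -normr_gt0.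
Qed.

Lemma horner_bounded (p : {poly R}) (t : R) : `|t| <= 1 ->
  `|p.[t]| <= \sum_(i < size p) `|p`_i|.
Proof.
move=> t1; rewrite horner_coef; apply: le_trans (ler_norm_sum _ _ _) _.
apply: ler_sum => i _; rewrite normrM normrX ler_piMr //.
exact: exprn_ile1.
Qed.

Lemma fps_truncM n (a b : fps R) :
  fps_trunc n (a * b) = take_poly n (fps_trunc n a * fps_trunc n b).
Proof.
apply/polyP => i; rewrite coef_take_poly coef_poly; case: ltnP => // ni.
by symmetry; apply: coefM_agree; apply: fps_trunc_agree.
Qed.

Lemma expandsM f g a b :
  expands f a -> expands g b -> expands (fun t => f t * g t) (a * b).
Proof.
move=> fa gb n; have [C [r [r0 fC]]] := fa n; have [D [s [s0 gD]]] := gb n.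
set p := fps_trunc n a in fC; set q := fps_trunc n b in gD.
pose T (u : {poly R}) := \sum_(i < size u) `|u`_i|.
have T0 u : 0 <= T u by apply: sumr_ge0.
exists (`|C| * (`|D| + T q) + T p * `|D| + T (drop_poly n (p * q))).
exists (Num.min 1 (Num.min r s)); split; first by rewrite !lt_min r0 s0 ltr01.
move=> t t0; rewrite !lt_min => /and3P[t1 tr ts].
have t1' := ltW t1; have tn0 : 0 <= `|t| ^+ n by rewrite exprn_ge0.
have tn1 : `|t| ^+ n <= 1 by apply: exprn_ile1.
have fCt : `|f t - p.[t]| <= `|C| * `|t| ^+ n.
  by apply: le_trans (fC t t0 tr) _; apply: ler_wpM2r => //; exact: ler_norm.
have gDt : `|g t - q.[t]| <= `|D| * `|t| ^+ n.
  by apply: le_trans (gD t t0 ts) _; apply: ler_wpM2r => //; exact: ler_norm.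
have gb1 : `|g t| <= `|D| + T q.
  rewrite -[g t](subrK q.[t]); apply: le_trans (ler_normD _ _) _.
  apply: lerD; last exact: horner_bounded.
  by apply: le_trans gDt _; rewrite ler_piMr.
have -> : f t * g t - (fps_trunc n (a * b)).[t] =
    (f t - p.[t]) * g t + p.[t] * (g t - q.[t])
    + (drop_poly n (p * q)).[t] * t ^+ n.
  rewrite fps_truncM -/p -/q.
  have := congr1 (fun u => u.[t]) (poly_take_drop n (p * q)).
  rewrite hornerD !hornerM hornerXn => E.
  have -> : (take_poly n (p * q)).[t] =
     p.[t] * q.[t] - (drop_poly n (p * q)).[t] * t ^+ n by rewrite -E addrK.
  ring.
apply: le_trans (ler_normD _ _) _; rewrite [leRHS]mulrDl.
apply: lerD; last first.
  by rewrite normrM normrX; apply: ler_wpM2r => //; exact: horner_bounded.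
apply: le_trans (ler_normD _ _) _; rewrite [leRHS]mulrDl; apply: lerD.
  rewrite normrM mulrAC; apply: ler_pM => //.
rewrite normrM -mulrA; apply: ler_pM => //; exact: horner_bounded.
Qed.

(** At the first coefficient where [a] and [b] differ, the two expansions are
incompatible for small t. *)
Lemma expands_unique f a b : expands f a -> expands f b -> a = b.
Proof.
move=> fa fb; apply: fpsP; elim/ltn_ind => n IH.
have [C [r [r0 fC]]] := fa n.+1; have [D [s [s0 fD]]] := fb n.+1.
apply/eqP/negPn/negP => ab; set d := `|a.%[n] - b.%[n]|.
have d0 : 0 < d by rewrite normr_gt0 subr_eq0.
pose E := `|C| + `|D| + 1.
have E0 : 0 < E by rewrite /E ltr_wpDl // addr_ge0.
pose t := Num.min (d / (2 * E)) (Num.min (r / 2) (s / 2)).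
have t0 : 0 < t.
  by rewrite /t !lt_min !divr_gt0 // ?mulr_gt0.
have tr : t < r.
  apply: (@le_lt_trans _ _ (r / 2)); last by rewrite ltr_pdivrMr // ltr_pMr // ltr1n.
  by rewrite /t !ge_min lexx !orbT.
have ts : t < s.
  apply: (@le_lt_trans _ _ (s / 2)); last by rewrite ltr_pdivrMr // ltr_pMr // ltr1n.
  by rewrite /t !ge_min lexx !orbT.
have td : t <= d / (2 * E) by rewrite /t ge_min lexx.
have tt : `|t| = t by rewrite gtr0_norm.
have := fC t; have := fD t; rewrite tt => /(_ t0 ts) h1 /(_ t0 tr) h2.
have tr1 (c : fps R) : (fps_trunc n.+1 c).[t] = (fps_trunc n c).[t] + c.%[n] * t ^+ n.
  by rewrite !horner_poly big_ord_recr.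
have eqn : (fps_trunc n a).[t] = (fps_trunc n b).[t].
  by rewrite !horner_poly; apply: eq_bigr => i _; rewrite IH.
have : d * t ^+ n <= E * t ^+ n.+1.
  apply: (@le_trans _ _ ((C + D) * t ^+ n.+1)); last first.
    rewrite ler_pM2r ?exprn_gt0 // /E -[C + D]addr0; apply: lerD => //.
    by apply: lerD; exact: ler_norm.
  have -> : d * t ^+ n = `|(fps_trunc n.+1 a).[t] - (fps_trunc n.+1 b).[t]|.
    rewrite !tr1 eqn opprD addrACA subrr add0r -mulrBl normrM -/d.
    by rewrite [`|t ^+ n|]ger0_norm // exprn_ge0 // ltW.
  rewrite -[X in `|X - _|](subrK (f t)) -addrA.
  apply: le_trans (ler_normD _ _) _; rewrite [leRHS]mulrDl distrC.
  exact: lerD.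
rewrite exprS mulrA ler_pM2r ?exprn_gt0 // => dCD.
have : d <= E * (d / (2 * E)) by rewrite (le_trans dCD) // ler_pM2l.
have -> : E * (d / (2 * E)) = d / 2 by field; rewrite gt_eqF.
by lra.
Qed.

Lemma sum_exp_le2 (q : R) k n : 0 <= q -> q <= 2^-1 ->
  \sum_(n <= s < n + k) q ^+ s <= 2 * q ^+ n.
Proof.
move=> q0 q2; elim: k n => [|k IH] n.
  by rewrite addn0 big_geq // mulr_ge0 // exprn_ge0.
rewrite addnS -addSn big_ltn; last by rewrite ltn_addr.
apply: (@le_trans _ _ (q ^+ n + 2 * q ^+ n.+1)); first by rewrite lerD2l.
have qn : 0 <= q ^+ n by rewrite exprn_ge0.
by rewrite exprS; nra.
Qed.

(** The terms are bounded at t = r / 2, so for |t| <= r / 4 the tail from degree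
n on is dominated by a geometric series of ratio at most 1/2. *)
Lemma expands_series f a (r : R) : 0 < r ->
  (forall t, 0 < `|t| -> `|t| < r ->
    series (fun s : nat => a.%[s] * t ^+ s) n @[n --> \oo] --> f t) ->
  expands f a.
Proof.
move=> r0 af n; pose t0 := r / 2.
have t00 : 0 < t0 by rewrite divr_gt0.
have t0r : t0 < r by rewrite /t0 ltr_pdivrMr // ltr_pMr // ltr1n.
have := af t0; rewrite gtr0_norm // => /(_ t00 t0r) cv.
have [K [_ /(_ (K + 1))]] : bounded_fun (fun s : nat => a.%[s] * t0 ^+ s).
  apply: cvg_seq_bounded; apply: (cvgP 0); apply: cvg_series_cvg_0.
  exact: (cvgP _ cv).
rewrite ltrDl ltr01 => /(_ isT) aK; set M := K + 1 in aK.
have M0 : 0 <= M by apply: le_trans (aK 0%N _).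
exists (M * 2 / t0 ^+ n), (t0 / 2); split; first by rewrite divr_gt0.
move=> t tp tt0; set q := `|t| / t0.
have q0 : 0 <= q by rewrite divr_ge0 // ltW.
have q2 : q <= 2^-1 by rewrite ler_pdivrMr // mulrC ltW.
have aq s : `|a.%[s] * t ^+ s| <= M * q ^+ s.
  rewrite /q expr_div_n mulrA ler_pdivlMr ?exprn_gt0 //.
  rewrite normrM normrX mulrAC; apply: ler_wpM2r; first by rewrite exprn_ge0.
  have := aK s I; rewrite /= normrM normrX (gtr0_norm t00); exact: id.
have cvt : series (fun s : nat => a.%[s] * t ^+ s) n @[n --> \oo] --> f t.
  apply: af => //; apply: (lt_trans tt0); rewrite /t0; lra.
have cvd : `|series (fun s : nat => a.%[s] * t ^+ s) m - (fps_trunc n a).[t]|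
    @[m --> \oo] --> `|f t - (fps_trunc n a).[t]|.
  by apply: cvg_norm; apply: cvgB cvt _; exact: cvg_cst.
have -> : M * 2 / t0 ^+ n * `|t| ^+ n = M * (2 * q ^+ n).
  rewrite [q ^+ n]expr_div_n -!mulrA; do 2!congr (_ * _); exact: mulrC.
apply: ler_cvg_to cvd (cvg_cst _) _ => /=.
near=> m.
have nm : (n <= m)%N by near: m; exact: nbhs_infty_ge.
rewrite horner_poly -(big_mkord xpredT (fun s => a.%[s] * t ^+ s)) /series /=.
rewrite (big_cat_nat (n := n)) //= addrAC subrr add0r.
apply: le_trans (ler_norm_sum _ _ _) _.
apply: (@le_trans _ _ (\sum_(n <= s < m) M * q ^+ s)); first exact: ler_sum.
rewrite -mulr_sumr; apply: ler_wpM2l => //.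
by rewrite -[m](subnKC nm); exact: sum_exp_le2.
Unshelve. all: by end_near. Qed.

(** The functions t / (exp t - 1) and (exp t - 1) / t have product 1 off 0, so
their expansions do too. *)
Lemma bernoulli_mul_expR1 (B : nat -> R) :
  is_bernoulli B -> bern_all B * fps_expR1 R = 1.
Proof.
move=> hB.
have eB : expands (fun t => t / (expR t - 1)) (bern_all B).
  have [r /= r0 Hr] := hB.
  apply: (expands_series r0) => t t0 tr.
  have := Hr t; rewrite /= sub0r normrN => /(_ tr); rewrite -normr_gt0 => /(_ t0).
  suff -> : series (fun s => B s * (t ^+ s / s`!%:R)) =
            series (fun s => (bern_all B).%[s] * t ^+ s) by [].
  by apply/funext => n; apply: eq_bigr => i _; rewrite /= mulrAC mulrA.
have eE : expands (fun t => (expR t - 1) / t) (fps_expR1 R).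
  apply: (expands_series ltr01) => t t0 _.
  have tn0 : t != 0 by rewrite -normr_gt0.
  have cv : series (exp_coeff t) n.+1 @[n --> \oo] --> expR t.
    by have := @is_cvg_series_exp_coeff R t; rewrite cvg_shiftS.
  have -> : series (fun s : nat => (fps_expR1 R).%[s] * t ^+ s) =
            fun n => (series (exp_coeff t) n.+1 - 1) / t; last first.
    by apply: cvgMr_tmp; apply: cvgB cv _; exact: cvg_cst.
  apply/funext => n.
  rewrite /series /= big_nat_recl // /exp_coeff /= expr0 fact0 divr1 addrC addKr mulr_suml.
  apply: eq_bigr => i _; rewrite exprS; set u := (_`!)%:R.
  by rewrite -mulrA mulrAC mulfV // mul1r mulrC.
have e1 : expands (fun=> 1) 1.
  move=> n; exists 1, 1; split => // t _ _; rewrite mul1r horner_poly.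
  case: n => [|n]; first by rewrite big_ord0 subr0 normr1.
  rewrite big_ord_recl big1 ?addr0 ?mul1r ?subrr ?normr0 ?exprn_ge0 // => i _.
  by rewrite fcoef1 /= mul0r.
apply: expands_unique e1; apply: (expands_ext _ (expandsM eB eE)) => t t0.
rewrite mulrA divfK ?mulfV //.
by rewrite subr_eq0 -expR0; apply: contra t0 => /eqP /expR_inj ->.
Qed.

End AsymptoticExpansion.

(** * Euler's product for the sine *)

Section SineProduct.
Variable R : realType.
Local Notation mu := (@lebesgue_measure R).

Definition itg (a : R) (f : R -> R) : R := (\int[mu]_(x in `[0%R, a]) (f x))%R.

Lemma continuous_integrable (a : R) (f : R -> R) : continuous f ->
  mu.-integrable `[0%R, a] (EFin \o f).
Proof.
move=> cf; apply: continuous_compact_integrable; first exact: segment_compact.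
exact: continuous_subspaceT.
Qed.

Lemma itgD a (f g : R -> R) : continuous f -> continuous g ->
  itg a (fun x => f x + g x) = itg a f + itg a g.
Proof. by move=> cf cg; rewrite /itg RintegralD //; exact: continuous_integrable. Qed.

Lemma itgZ a c (f : R -> R) : continuous f ->
  itg a (fun x => c * f x) = c * itg a f.
Proof. by move=> cf; rewrite /itg RintegralZl //; exact: continuous_integrable. Qed.

Lemma le_itg a (f g : R -> R) : continuous f -> continuous g ->
  (forall x, 0 <= x <= a -> f x <= g x) -> itg a f <= itg a g.
Proof.
move=> cf cg fg; apply: le_Rintegral => //; try exact: continuous_integrable.
Qed.

Lemma itg_ge0 a (f : R -> R) :
  (forall x, 0 <= x <= a -> 0 <= f x) -> 0 <= itg a f.
Proof.
by move=> f0; apply: Rintegral_ge0 => x /=; rewrite in_itv /=; exact: f0.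
Qed.

Lemma is_derive_continuous (F f : R -> R) :
  (forall x : R, is_derive x 1 F (f x)) -> continuous F.
Proof.
by move=> dF x; apply: differentiable_continuous; apply/derivable1_diffP.
Qed.

Lemma itg_derive a (F f : R -> R) : 0 < a ->
  (forall x : R, is_derive x 1 F (f x)) -> continuous f -> itg a f = F a - F 0.
Proof.
move=> a0 dF cf; have cF := is_derive_continuous dF.
rewrite /itg /Rintegral (@continuous_FTC2 _ f F) //.
- exact: continuous_subspaceT.
- split => [x _ //||].
  + exact/cvg_at_right_filter/cF.
  + exact/cvg_at_left_filter/cF.
- by move=> x _; rewrite derive1E derive_val.
Qed.

Lemma continuous_mul (f g : R -> R) : continuous f -> continuous g ->
  continuous (fun x => f x * g x).
Proof. by move=> cf cg x; apply: cvgM; [exact: cf|exact: cg]. Qed.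

Lemma continuous_exp (f : R -> R) n : continuous f ->
  continuous (fun x => f x ^+ n).
Proof.
move=> cf; elim: n => [|n IH]; first by move=> x; exact: cvg_cst.
under eq_fun do rewrite exprS; exact: continuous_mul.
Qed.

Lemma is_derive_mul (f g : R -> R) (x df dg : R) :
  is_derive x 1 f df -> is_derive x 1 g dg ->
  is_derive x 1 (fun x => f x * g x) (df * g x + f x * dg).
Proof.
move=> hf hg; apply: (@is_derive_eq _ _ _ (f * g)).
by rewrite /GRing.scale /=; ring.
Qed.

Lemma is_derive_cosX n (x : R) :
  is_derive x 1 (fun x => cos x ^+ n.+1) (- (n.+1%:R * cos x ^+ n * sin x)).
Proof.
have -> : (fun x : R => cos x ^+ n.+1) = cos ^+ n.+1 by rewrite exprfctE.
by apply: is_derive_eq; rewrite /GRing.scale /= mulrN.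
Qed.

(** The difference of the two sides is the integral of the derivative of
u1 cos^(n+2) + (n+2) u cos^(n+1) sin, which vanishes at 0 and at pi/2. *)
Lemma itg_by_parts n (u u1 u2 : R -> R) :
  (forall x : R, is_derive x 1 u (u1 x)) -> (forall x : R, is_derive x 1 u1 (u2 x)) ->
  continuous u2 -> u1 0 = 0 ->
  itg (pi / 2) (fun x => u2 x * cos x ^+ n.+2)
    + n.+2%:R ^+ 2 * itg (pi / 2) (fun x => u x * cos x ^+ n.+2)
  = (n.+2 * n.+1)%:R * itg (pi / 2) (fun x => u x * cos x ^+ n).
Proof.
move=> du du1 cu2 u10.
have cu := is_derive_continuous du; have cu1 := is_derive_continuous du1.
have cc k : continuous (fun x : R => cos x ^+ k).
  by apply: continuous_exp; exact: continuous_cos.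
pose F x := u1 x * cos x ^+ n.+2 + n.+2%:R * (u x * (cos x ^+ n.+1 * sin x)).
pose f x := (u2 x * cos x ^+ n.+2 + n.+2%:R ^+ 2 * (u x * cos x ^+ n.+2))
            + - (n.+2 * n.+1)%:R * (u x * cos x ^+ n).
have dF (x : R) : is_derive x 1 F (f x).
  have d1 := is_derive_mul (du1 x) (is_derive_cosX n.+1 x).
  have d2 := is_derive_mul (du x)
               (is_derive_mul (is_derive_cosX n x) (is_derive_sin x)).
  have d3 := is_deriveD d1 (is_deriveZ n.+2%:R d2).
  apply: (is_derive_eq d3); rewrite /f /GRing.scale /=.
  have s2 : sin x * sin x = 1 - cos x ^+ 2 by rewrite -expr2 sin2cos2.
  rewrite natrM !exprS.
  transitivity (u2 x * (cos x * (cos x * cos x ^+ n)) + n.+2%:R *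
     (u x * (cos x * (cos x * cos x ^+ n) - n.+1%:R * cos x ^+ n * (sin x * sin x)))).
    by ring.
  rewrite s2 -[n.+2]addn1 natrD; ring.
have c1 := continuous_mul cu2 (cc n.+2).
have c2 := continuous_mul cu (cc n.+2).
have c3 := continuous_mul cu (cc n).
have cZ c (h : R -> R) : continuous h -> continuous (fun x => c * h x).
  by move=> ch; apply: continuous_mul ch => x; exact: cvg_cst.
have cD (h k : R -> R) : continuous h -> continuous k ->
    continuous (fun x => h x + k x).
  by move=> ch ck x; apply: cvgD; [exact: ch|exact: ck].
have pi20 : 0 < pi / 2 :> R by rewrite divr_gt0 // pi_gt0.
have := itg_derive pi20 dF (cD _ _ (cD _ _ c1 (cZ _ _ c2)) (cZ _ _ c3)).
have -> : F (pi / 2) = 0 by rewrite /F cos_pihalf exprS !mul0r mulr0 exprS !mul0r !mulr0 addr0.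
have -> : F 0 = 0 by rewrite /F u10 sin0 !mulr0 mul0r addr0.
rewrite subr0 /f itgD ?itgD ?itgZ //; try by [exact: cZ | exact: cD | apply: cD => //; exact: cZ].
by move/eqP; rewrite mulNr subr_eq0 => /eqP.
Qed.

Definition monom (k : nat) (x : R) : R := x ^+ k / k`!%:R.

Lemma is_derive_monom k (x : R) : is_derive x 1 (monom k.+1) (monom k x).
Proof.
have -> : monom k.+1 = (k.+1)`!%:R^-1 *: (id ^+ k.+1).
  by apply/funext => y; rewrite /monom exprfctE mulrC.
apply: is_derive_eq; rewrite /GRing.scale /= mulr1 /monom factS natrM.
have : k.+1%:R != 0 :> R by rewrite pnatr_eq0.
have : k`!%:R != 0 :> R by rewrite pnatr_eq0 -lt0n fact_gt0.
by move: k`!%:R k.+1%:R => u v u0 v0; field; rewrite u0 v0.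
Qed.

Lemma continuous_monom k : continuous (monom k).
Proof. by apply: continuous_mul (fun x => cvg_cst _); exact: continuous_exp (fun x => cvg_id). Qed.

Lemma monom0 x : monom 0 x = 1.
Proof. by rewrite /monom expr0 fact0 divr1. Qed.

(** Up to signs these are the Taylor coefficients in z of the integral of
cos(z x) cos(x)^n over 0 <= x <= pi/2. *)
Definition cosmom n l : R := itg (pi / 2) (fun x => monom (2 * l) x * cos x ^+ n).

Lemma cosmom_rec0 n :
  n.+2%:R ^+ 2 * cosmom n.+2 0 = (n.+2 * n.+1)%:R * cosmom n 0.
Proof.
have cst0 : continuous (fun _ : R => 0 : R) by move=> x; exact: cvg_cst.
have m0 : monom 0 = cst 1 by apply/funext => x; rewrite monom0.
have d0 (x : R) : is_derive x 1 (monom 0) 0 by rewrite m0; exact: is_derive_cst.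
have d1 (x : R) : is_derive x 1 (fun _ : R => 0 : R) 0 by exact: is_derive_cst.
rewrite /cosmom muln0 -(itg_by_parts n d0 d1) //.
by rewrite itgZ ?mul0r ?add0r //; apply: continuous_exp; exact: continuous_cos.
Qed.

Lemma cosmom_rec n l :
  cosmom n.+2 l + n.+2%:R ^+ 2 * cosmom n.+2 l.+1
  = (n.+2 * n.+1)%:R * cosmom n l.+1.
Proof.
rewrite /cosmom (_ : 2 * l.+1 = (2 * l).+2)%N; last by rewrite mulnS.
apply: (@itg_by_parts n _ (monom (2 * l).+1)).
- exact: is_derive_monom.
- exact: is_derive_monom.
- exact: continuous_monom.
- by rewrite /monom exprS mul0r mul0r.
Qed.

Let pi20 : 0 < pi / 2 :> R. Proof. by rewrite divr_gt0 // pi_gt0. Qed.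

Lemma cosmom00 l : cosmom 0 l = monom (2 * l).+1 (pi / 2).
Proof.
rewrite /cosmom; have -> : (fun x : R => monom (2 * l) x * cos x ^+ 0) = monom (2 * l).
  by apply/funext => x; rewrite expr0 mulr1.
rewrite (itg_derive pi20 (is_derive_monom _) (@continuous_monom _)).
by rewrite [X in _ - X]/monom exprS !mul0r subr0.
Qed.

Lemma cosmom_gt0 n : 0 < cosmom (2 * n) 0.
Proof.
elim: n => [|n IH]; first by rewrite cosmom00 /monom expr1 divr1.
have h : 0 < (2 * n).+2%:R ^+ 2 * cosmom (2 * n).+2 0.
  by rewrite cosmom_rec0 mulr_gt0 // ltr0n.
have h0 : 0 < (2 * n).+2%:R ^+ 2 :> R by apply: exprn_gt0; rewrite ltr0n.
by move: h; rewrite (pmulr_rgt0 _ h0) mulnS.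
Qed.

(** If cos x >= 1/2 this follows from x cos x <= sin x; otherwise
sin x >= sin^2 x >= 3/4, while x <= pi/2 < 2. *)
Lemma le_x_3sin (x : R) : 0 <= x <= pi / 2 -> x <= 3 * sin x.
Proof.
move=> /andP[x0 xp]; have [->|xn0] := eqVneq x 0; first by rewrite sin0 mulr0.
have xp0 : 0 < x by rewrite lt_neqAle eq_sym xn0.
have sinx y : 0 <= y <= x -> 0 <= sin y.
  move=> /andP[y0 yx]; apply: sin_ge0_pi; rewrite y0 (le_trans yx) //.
  by rewrite (le_trans xp) // ler_pdivrMr ?ler_pMr ?ler1n // pi_gt0.
have dF (y : R) : is_derive y 1 (fun y : R => sin y - y * cos y) (y * sin y).
  have d := is_deriveB (is_derive_sin y) (is_derive_mul (@is_derive_id _ _ y 1) (is_derive_cos y)).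
  by apply: (is_derive_eq d); ring.
have h : x * cos x <= sin x.
  have := itg_derive xp0 dF (continuous_mul (fun y => cvg_id) (@continuous_sin R)).
  rewrite sin0 mul0r !subr0 -subr_ge0 => <-; apply: itg_ge0 => y yx.
  by rewrite mulr_ge0 ?sinx //; case/andP: yx.
have x2 : x < 2 by rewrite (le_lt_trans xp) // pihalf_lt2.
have s0 : 0 <= sin x by rewrite sinx // ltW //= lexx.
have c0 : 0 <= cos x.
  by apply: cos_ge0_pihalf; rewrite xp andbT (le_trans _ x0) // oppr_le0 ltW.
have := cos2Dsin2 x; have := sin_le1 x; move: h s0 c0.
move: (sin x) (cos x) => s c h s0 c0 s1 sc.
have [c2|c2] := lerP (2^-1) c; first by nra.
have : c * c <= 4^-1 by nra.
have : s * s <= s by nra.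
by move: sc; rewrite !expr2; lra.
Qed.

(** As n grows, cos^(2n) concentrates at 0: since x^2 <= 9 sin^2 x, the moment of
order l + 1 is at most a multiple of the integral of sin^2 cos^(2n), which is the
difference of two consecutive moments of order 0. *)
Lemma cosmom_small l : exists C : R, forall n,
  0 <= cosmom (2 * n) l.+1 / cosmom (2 * n) 0 <= C / n.+1%:R.
Proof.
(* 9 bounds (x / sin x)^2, and 4 bounds the remaining factors x^2. *)
exists (9 * 4 ^+ l) => n; have J0 := cosmom_gt0 n; have J1 := cosmom_gt0 n.+1.
have cc k : continuous (fun x : R => cos x ^+ k).
  by apply: continuous_exp; exact: continuous_cos.
have xpos (x : R) : 0 <= x <= pi / 2 -> 0 <= monom (2 * l.+1) x <= 9 * 4 ^+ l * (1 - cos x ^+ 2).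
  move=> xp; have /andP[x0 x1] := xp.
  rewrite divr_ge0 ?exprn_ge0 //= -sin2cos2.
  apply: (@le_trans _ _ (x ^+ (2 * l.+1))).
    rewrite ler_pdivrMr ?ltr0n ?fact_gt0 // ler_peMr ?exprn_ge0 //.
    by rewrite ler1n fact_gt0.
  rewrite mulnS exprD exprM [leRHS]mulrAC.
  apply: ler_pM; rewrite ?exprn_ge0 ?sqr_ge0 //.
    rewrite (_ : 9 = 3 ^+ 2); last by rewrite -natrX.
    have h := le_x_3sin xp.
    by rewrite -exprMn; apply: lerXn2r; rewrite ?nnegrE // (le_trans x0).
  rewrite (_ : 4 = 2 ^+ 2); last by rewrite -natrX.
  do 2![apply: lerXn2r; rewrite ?nnegrE ?sqr_ge0 //].
  by rewrite (le_trans x1) // ltW // pihalf_lt2.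
have cos20 (x : R) : 0 <= cos x ^+ (2 * n) by rewrite exprM exprn_ge0 // sqr_ge0.
apply/andP; split.
  apply: divr_ge0; last exact: ltW.
  by apply: itg_ge0 => x /xpos /andP[h _]; rewrite mulr_ge0.
rewrite ler_pdivrMr //.
have le1 : cosmom (2 * n) l.+1 <= 9 * 4 ^+ l * (cosmom (2 * n) 0 - cosmom (2 * n.+1) 0).
  rewrite /cosmom muln0.
  have m0 k : itg (pi / 2) (fun x => monom 0 x * cos x ^+ k) = itg (pi / 2) (fun x : R => cos x ^+ k).
    by congr itg; apply/funext => x; rewrite monom0 mul1r.
  rewrite !m0 -mulN1r -itgZ // -itgD //; last first.
    by apply: continuous_mul (cc _) => x; exact: cvg_cst.
  rewrite -itgZ; last first.
    by move=> x; apply: cvgD; [exact: cc|apply: cvgMl_tmp; exact: cc].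
  apply: le_itg.
  - by apply: continuous_mul (cc _); exact: continuous_monom.
  - by move=> x; apply: cvgMl_tmp; apply: cvgD; [exact: cc|apply: cvgMl_tmp; exact: cc].
  - move=> x /xpos /andP[_ h].
    have -> : 9 * 4 ^+ l * (cos x ^+ (2 * n) + -1 * cos x ^+ (2 * n.+1)) =
        9 * 4 ^+ l * (1 - cos x ^+ 2) * cos x ^+ (2 * n).
      by rewrite [(2 * n.+1)%N]mulnS exprD; ring.
    exact: ler_wpM2r.
apply: le_trans le1 _; rewrite [leRHS]mulrAC -[leRHS]mulrA; apply: ler_wpM2l.
  by rewrite mulr_ge0 // exprn_ge0.
have E := cosmom_rec0 (2 * n).
have -> : (2 * n.+1 = (2 * n).+2)%N by rewrite mulnS.
have J2 : 0 < cosmom (2 * n).+2 0 by move: J1; rewrite mulnS.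
move: E J0 J2; set a := cosmom _ 0; set b := cosmom _ 0 => E b0 a0.
rewrite ler_pdivlMr ?ltr0n //.
have e1 : (2 * n).+2%:R = 2 * n.+1%:R :> R by rewrite -natrM mulnS.
have e2 : (2 * n).+1%:R = 2 * n.+1%:R - 1 :> R by rewrite -e1 -[in RHS]natr1 addrK.
have n1 : 1 <= n.+1%:R :> R by rewrite ler1n.
move: E; rewrite natrM e1 e2; move: n.+1%:R n1 => N N1 E.
have N0 : N != 0 by rewrite gt_eqF // (lt_le_trans ltr01).
have {}E : 2 * N * a = (2 * N - 1) * b.
  apply: (mulfI (_ : 2 * N != 0)); first by rewrite mulf_neq0 // pnatr_eq0.
  by rewrite mulrA -expr2 E mulrA.
nra.
Qed.

Definition cosmom_fps n : fps R :=
  Fps (fun l => cosmom (2 * n) l / cosmom (2 * n) 0).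

(** The integrations by parts [cosmom_rec0] and [cosmom_rec], normalised: each
step extracts one factor of Euler's product. *)
Lemma cosmom_fps_rec n :
  cosmom_fps n = (1 + fpsC (4^-1 * n.+1%:R ^- 2) * fpsX) * cosmom_fps n.+1.
Proof.
have J0 := cosmom_gt0 n; have J1 := cosmom_gt0 n.+1.
apply: fpsP => -[|l]; rewrite mulrDl mul1r -mulrA fcoefD fcoefCM fcoefXM /=.
  by rewrite mulr0 addr0 !divff ?gt_eqF.
have E0 := cosmom_rec0 (2 * n); have E := cosmom_rec (2 * n) l.
have e2 : (2 * n.+1 = (2 * n).+2)%N by rewrite mulnS.
rewrite !e2 in J1 *.
have e1 : (2 * n).+2%:R = 2 * n.+1%:R :> R by rewrite -natrM mulnS.
have n0 : (2 * n).+1%:R != 0 :> R by rewrite pnatr_eq0.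
have N0 : n.+1%:R != 0 :> R by rewrite pnatr_eq0.
move: E0 E J0 J1; rewrite natrM e1.
move: (cosmom (2 * n) 0) (cosmom (2 * n) l.+1) (cosmom (2 * n).+2 0)
  (cosmom (2 * n).+2 l) (cosmom (2 * n).+2 l.+1) => a b c d e.
move: (2 * n).+1%:R n.+1%:R n0 N0 => p N p0 N0 E0 E a0 c0.
have cn0 : c != 0 by rewrite gt_eqF.
have -> : a = 2 * N * c / p.
  apply: (mulfI (_ : 2 * N * p != 0)); first by rewrite !mulf_neq0 // pnatr_eq0.
  by rewrite -E0; field.
have -> : d = 2 * N * p * b - (2 * N) ^+ 2 * e by rewrite -E addrK.
by field; rewrite N0 cn0 p0.
Qed.

Definition sin_prod n : fps R := \prod_(k < n) (1 - fpsC (k.+1%:R ^- 2) * fpsX).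

Lemma cvg_sum_ord l (u : 'I_l -> nat -> R) (a : 'I_l -> R) :
  (forall i, u i n @[n --> \oo] --> a i) ->
  \sum_(i < l) u i n @[n --> \oo] --> \sum_(i < l) a i.
Proof.
elim: l u a => [|l IH] u a ua.
  by rewrite big_ord0; under eq_fun do rewrite big_ord0; exact: cvg_cst.
rewrite big_ord_recr; under eq_fun do rewrite big_ord_recr.
by apply: cvgD => //; exact: IH.
Qed.

(** The coefficients of A_n are determined one after the other by those of K_n
and of the constant product A_n K_n. *)
Lemma cvg_fps_cofactor (A K : nat -> fps R) (f : fps R) :
  (forall n, A n * K n = f) -> (forall n, (K n).%[0] = 1) ->
  (forall l, (K n).%[l.+1] @[n --> \oo] --> (0 : R)) ->
  forall l, (A n).%[l] @[n --> \oo] --> f.%[l].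
Proof.
move=> AK K0 Kl; elim/ltn_ind => l IH.
have E n : (A n).%[l] = f.%[l] - \sum_(i < l) (A n).%[i] * (K n).%[l - i].
  rewrite -(AK n) fcoefM big_ord_recr /= subnn K0 mulr1.
  by rewrite addrAC subrr add0r.
have -> : (fun n => (A n).%[l]) =
    (fun n => f.%[l] - \sum_(i < l) (A n).%[i] * (K n).%[l - i]).
  by apply/funext.
rewrite -[X in _ --> X]subr0; apply: cvgB; first exact: cvg_cst.
have S0 : \sum_(i < l) (f.%[i] * 0) = 0 by rewrite big1 // => i _; rewrite mulr0.
rewrite -[X in _ --> X]S0.
apply: cvg_sum_ord => i.
apply: cvgM; first exact: IH.
by rewrite -(prednK (n := l - i)) ?subn_gt0 //; exact: Kl.
Qed.

(** Euler's product for the sine: the factors extracted by [cosmom_fps_rec]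
leave a cofactor that tends to 1. *)
Lemma cvg_sin_prod l :
  (sin_prod n).%[l] @[n --> \oo] --> (scl (- pi ^+ 2) (sinhc R)).%[l].
Proof.
pose A n : fps R := \prod_(k < n) (1 + fpsC (4^-1 * k.+1%:R ^- 2) * fpsX).
have AE n : A n * cosmom_fps n = cosmom_fps 0.
  elim: n => [|n <-]; first by rewrite /A big_ord0 mul1r.
  by rewrite /A big_ord_recr /= -mulrA -cosmom_fps_rec.
have sE n : sin_prod n = scl (-4) (A n).
  rewrite /A rmorph_prod; apply: eq_bigr => k _.
  rewrite rmorphD rmorph1 rmorphM /= sclC sclX; congr (_ + _).
  apply: fpsP => j; rewrite fcoefN !fcoefCM !mulrA -mulNr; congr (_ * _).
  by rewrite mulrN mulrAC mulVf ?mul1r // pnatr_eq0.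
have -> : (scl (- pi ^+ 2) (sinhc R)).%[l] = (scl (-4) (cosmom_fps 0)).%[l].
  rewrite /= muln0 !cosmom00 /monom expr1 (_ : 1`! = 1%N) // divr1 addn1.
  have -> : - pi ^+ 2 = -4 * (pi / 2) ^+ 2 :> R by field.
  have h0 : pi / 2 != 0 :> R by rewrite gt_eqF.
  move: (pi / 2) h0 => h h0; rewrite exprMn [h ^+ (2 * l).+1]exprS [h ^+ (2 * l)]exprM.
  by move: (_ ^+ l) (h ^+ 2 ^+ l) (_^-1) => x y z; field.
under eq_fun do rewrite sE /=.
apply: cvgM; first exact: cvg_cst.
apply: (cvg_fps_cofactor AE) => [n|k].
  by rewrite /= divff // gt_eqF // cosmom_gt0.
have [C HC] := cosmom_small k.
have Ch : C * n.+1%:R^-1 @[n --> \oo] --> (0 : R).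
  by rewrite -[X in _ --> X](mulr0 C); apply: cvgMl_tmp; exact: cvg_harmonic.
apply: (squeeze_cvgr _ (cvg_cst 0) Ch).
by near=> n; exact: HC.
Unshelve. all: by end_near. Qed.

End SineProduct.

(** * Truncated star sums *)

Section StarSums.
Variable R : realType.

(** The star sum truncated to k_1 <= n. *)
Fixpoint zstar (s : seq nat) (n : nat) : R :=
  if s is a :: s' then \sum_(j < n) zstar s' j.+1 / j.+1%:R ^+ a else 1.

(** This is binom(2n, n + k) / binom(2n, n); the factor n - k makes it vanish
for k > n. *)
Fixpoint cbin (n k : nat) : R :=
  if k is k'.+1 then cbin n k' * (n%:R - k'%:R) / (n + k').+1%:R else 1.

Definition cbin_sum (a : nat -> R) (n : nat) : R := \sum_(k < n.+1) a k * cbin n k.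

Lemma cbinS n k :
  (n%:R + k.+1%:R) * cbin n k.+1 = (n%:R - k%:R) * cbin n k.
Proof.
rewrite -natrD addnS [cbin n k.+1]/=; have : (n + k).+1%:R != 0 :> R by rewrite pnatr_eq0.
by move: (n + k).+1%:R => N N0; field.
Qed.

Lemma cbin_small n k : (n < k)%N -> cbin n k = 0.
Proof.
elim: k => // k IH; rewrite ltnS leq_eqVlt => /predU1P[->|nk] /=.
  by rewrite subrr mulr0 mul0r.
by rewrite IH // !mul0r.
Qed.

Lemma cbin_sum_le a n N : (n < N)%N -> cbin_sum a n = \sum_(k < N) a k * cbin n k.
Proof.
move=> nN; rewrite /cbin_sum -(subnKC nN) big_split_ord -[LHS]addr0.
congr (_ + _); symmetry; apply: big1 => i _.
by rewrite cbin_small ?mulr0 ?leq_addr.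
Qed.

(** The difference of c(n+1, k) and c(n, k) is k^2 / (n+1)^2 times c(n+1, k):
this makes c(-, k) an eigenvector of the summation with weights 1 / j^2. *)
Lemma cbin_succ n k :
  n.+1%:R ^+ 2 * cbin n k = (n.+1%:R ^+ 2 - k%:R ^+ 2) * cbin n.+1 k.
Proof.
elim: k => [|k IH]; first by rewrite expr0n subr0.
have N0 j : n%:R + j.+1%:R != 0 :> R by rewrite -natrD addnS pnatr_eq0.
apply: (mulfI (N0 k)); rewrite mulrCA cbinS mulrCA IH.
have e1 j : j.+1%:R = j%:R + 1 :> R by rewrite natr1.
have := cbinS n.+1 k; have := N0 k.+1; rewrite !e1.
move: (cbin n.+1 k) (cbin n.+1 k.+1) (n%:R : R) (k%:R : R) => c d x y h E.
apply: (mulfI h).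
transitivity ((x - y) * (x + (y + 1)) * (x + (y + 1 + 1)) * ((x + 1 - y) * c)); first by ring.
by rewrite -E; ring.
Qed.

(** Both sides have the same increments in [n], by [cbin_succ]. *)
Lemma star_sum_cbin (e : nat) (f : nat -> R) (b : nat -> R) :
  b 0 = 0 ->
  (forall n, n.+1%:R ^+ e * cbin_sum (fun k => b k * k%:R ^+ 2) n.+1 =
             n.+1%:R ^+ 2 * f n.+1) ->
  forall n, \sum_(j < n) f j.+1 / j.+1%:R ^+ e = cbin_sum b n.
Proof.
move=> b0 bf; elim=> [|n IH].
  by rewrite big_ord0 /cbin_sum big_ord1 b0 mul0r.
have n0 : n.+1%:R != 0 :> R by rewrite pnatr_eq0.
rewrite big_ord_recr /= IH (@cbin_sum_le b n n.+2) //.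
apply/eqP; rewrite eq_sym addrC -subr_eq -sumrB; apply/eqP.
apply: (mulfI (expf_neq0 2 n0)); rewrite mulr_sumr.
apply: (mulfI (expf_neq0 e n0)).
transitivity (n.+1%:R ^+ 2 * f n.+1); last first.
  by rewrite [RHS]mulrCA [_ ^+ e * _]mulrC divfK // expf_neq0.
rewrite -bf; congr (_ * _).
apply: eq_bigr => k _.
by rewrite mulrBr [X in _ - X]mulrCA cbin_succ; ring.
Qed.

(** Summation by parts for the weights [cbin n k], on which multiplication by
[n] acts by a bidiagonal matrix. *)
Lemma cbin_abel n N (a S : nat -> R) :
  S 0 = 0 -> (forall k, S k.+1 = S k + a k) ->
  \sum_(k < N) a k * (n%:R * cbin n k) =
  \sum_(k < N) (S k.+1 + S k) * (k%:R * cbin n k) + S N * ((n%:R + N%:R) * cbin n N).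
Proof.
move=> S0 Sa; elim: N => [|N IH]; first by rewrite !big_ord0 S0 mul0r addr0.
rewrite !big_ord_recr /= IH cbinS.
have -> : a N = S N.+1 - S N by rewrite Sa addrAC subrr add0r.
by ring.
Qed.

Lemma cbin_abel_full n (a S : nat -> R) :
  S 0 = 0 -> (forall k, S k.+1 = S k + a k) ->
  n%:R * cbin_sum a n = cbin_sum (fun k => (S k.+1 + S k) * k%:R) n.
Proof.
move=> S0 Sa; have := cbin_abel n n.+1 S0 Sa.
rewrite [cbin n n.+1]cbin_small // !mulr0 addr0 => E.
rewrite /cbin_sum mulr_sumr.
transitivity (\sum_(k < n.+1) a k * (n%:R * cbin n k)).
  by apply: eq_bigr => k _; rewrite mulrCA.
by rewrite E; apply: eq_bigr => k _; rewrite mulrA.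
Qed.

Lemma eq_cbin_sum a b n : (forall k, a k = b k) -> cbin_sum a n = cbin_sum b n.
Proof. by move=> ab; apply: eq_bigr => k _; rewrite ab. Qed.

(** The case n = 0 is left out so that the empty index has two expansions, with
and without a term k = 0; the next entry of an index only uses n >= 1. *)
Definition star_expansion (s : seq nat) (a : nat -> R) :=
  forall n, zstar s n.+1 = cbin_sum a n.+1.

Lemma eq_star_expansion s a b : (forall k, a k = b k) ->
  star_expansion s a -> star_expansion s b.
Proof. by move=> ab sa n; rewrite sa; exact: eq_cbin_sum. Qed.

Lemma star_expansion2 s a : a 0 = 0 -> star_expansion s a ->
  star_expansion (2%N :: s) (fun k => a k / k%:R ^+ 2).
Proof.
move=> a0 sa n; apply: (@star_sum_cbin _ (zstar s)); first by rewrite a0 mul0r.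
move=> j; rewrite sa; congr (_ * _); apply: eq_cbin_sum => -[|k].
  by rewrite a0 !mul0r.
by rewrite divfK // expf_neq0 // pnatr_eq0.
Qed.

Lemma star_expansion_nseq2 p s a : a 0 = 0 -> star_expansion s a ->
  star_expansion (nseq p 2%N ++ s) (fun k => a k / k%:R ^+ (2 * p)).
Proof.
move=> a0 sa; elim: p => [|p IH] n.
  rewrite muln0 sa; apply: eq_cbin_sum => k; by rewrite expr0 divr1.
have := star_expansion2 _ IH; rewrite a0 mul0r => /(_ erefl n) ->.
apply: eq_cbin_sum => k.
by rewrite mulnS addnC exprD -mulrA -invfM.
Qed.

Lemma star_expansion1 s a S : S 0 = 0 -> (forall k, S k.+1 = S k + a k) ->
  star_expansion s a ->
  star_expansion (1%N :: s) (fun k => (S k.+1 + S k) / k%:R).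
Proof.
move=> S0 Sa sa n; apply: (@star_sum_cbin _ (zstar s)); first by rewrite invr0 mulr0.
move=> j; rewrite sa expr1 [in RHS]expr2 -[RHS]mulrA; congr (_ * _).
rewrite (cbin_abel_full _ S0 Sa); apply: eq_cbin_sum => -[|k].
  by rewrite expr0n !mulr0.
by rewrite expr2 mulrA divfK // pnatr_eq0.
Qed.

(** The inverse of multiplication by n is not bidiagonal, but it becomes a
summation after the signs (-1)^k: the partial sums of the new coefficients
times k^2 telescope to (-1)^k H. *)
Lemma star_expansion3 s a H : a 0 = 0 -> H 0 = 0 ->
  (forall k, H k.+1 = H k + (-1) ^+ k * (a k / k%:R)) ->
  star_expansion s a ->
  star_expansion (3%N :: s) (fun k => (-1) ^+ k * (H k.+1 + H k) / k%:R ^+ 2).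
Proof.
move=> a0 H0 Ha sa n; apply: (@star_sum_cbin _ (zstar s)).
  by rewrite expr0n /= invr0 mulr0.
pose G k := if k is k'.+1 then (-1) ^+ k' * H k'.+1 else 0.
have GE k : G k = - ((-1) ^+ k * H k).
  by case: k => [|k] /=; rewrite ?H0 ?mulr0 ?oppr0 // exprS mulN1r mulNr opprK.
have Gg k : G k.+1 = G k + (-1) ^+ k * (H k.+1 + H k) by rewrite [in RHS]GE /=; ring.
move=> j; have E := cbin_abel_full j.+1 (erefl : G 0 = 0) Gg.
rewrite sa exprSr -mulrA; congr (_ * _).
transitivity (j.+1%:R * cbin_sum (fun k => (-1) ^+ k * (H k.+1 + H k)) j.+1).
  congr (_ * _); apply: eq_cbin_sum => -[|k].
    by rewrite Ha a0 mul0r mulr0 H0 !addr0 mulr0 !mul0r.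
  by rewrite divfK // expf_neq0 // pnatr_eq0.
rewrite E; apply: eq_cbin_sum => -[|k]; first by rewrite a0 mulr0.
rewrite (GE k.+1) [G k.+2]/= [H k.+2]Ha.
have k0 : k.+1%:R != 0 :> R by rewrite pnatr_eq0.
have s2 : (-1) ^+ k.+1 * (-1) ^+ k.+1 = 1 :> R by rewrite -expr2 sqrr_sign.
transitivity ((-1) ^+ k.+1 * (-1) ^+ k.+1 * (a k.+1 / k.+1%:R * k.+1%:R)).
  by ring.
by rewrite s2 mul1r divfK.
Qed.

Lemma star_expansion_nil : star_expansion [::] (fun k => (k == 0)%:R).
Proof.
move=> n; rewrite /cbin_sum big_ord_recl /= mulr1 big1 ?addr0 // => i _.
by rewrite mul0r.
Qed.

(** The alternating sum of the numbers binom(2n, n + k) over all integers k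
vanishes for n > 0; this replaces the term k = 0 by the others. *)
Lemma star_expansion_nil_alt :
  star_expansion [::] (fun k => if k is 0 then 0 else - (2 * (-1) ^+ k)).
Proof.
move=> n; set e := (fun k : nat => _).
have H N : n.+1%:R * (1 - \sum_(k < N.+1) e k * cbin n.+1 k) =
    (-1) ^+ N * ((n.+1%:R + N.+1%:R) * cbin n.+1 N.+1).
  elim: N => [|N IH]; first by rewrite big_ord1 /= cbinS mul0r !subr0 !mul1r.
  rewrite big_ord_recr opprD addrA mulrDr IH [in RHS]cbinS.
  have -> : e (@ord_max N.+1) = 2 * (-1) ^+ N by rewrite /e /= exprS mulN1r mulrN opprK.
  by rewrite [nat_of_ord _]/= exprS; ring.
have := H n.+1; rewrite [cbin _ n.+2]cbin_small // !mulr0 => /eqP.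
by rewrite mulf_eq0 pnatr_eq0 /= subr_eq0 => /eqP.
Qed.

Section Blocks.
Variable m : nat.

(** This is (-1)^(k-1) / k^(2m+2). *)
Definition yval (k : nat) : R := - ((-1) ^+ k / k%:R ^+ (2 * m + 2)).

(** The coefficient of X^D in the product over 1 <= k <= n of
(1 + y_k X) / (1 - y_k X). *)
Fixpoint pcoef (D n : nat) : R :=
  if D is D'.+1 then \sum_(k < n) yval k.+1 * (pcoef D' k.+1 + pcoef D' k) else 1.

Definition pincr (D k : nat) : R :=
  if k is k'.+1 then pcoef D k'.+1 - pcoef D k' else (D == 0)%:R.

Lemma pcoefS D n :
  pcoef D.+1 n.+1 = pcoef D.+1 n + yval n.+1 * (pcoef D n.+1 + pcoef D n).
Proof. by rewrite [LHS]/= big_ord_recr. Qed.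

Lemma pincrS D k : pincr D.+1 k.+1 = yval k.+1 * (pcoef D k.+1 + pcoef D k).
Proof. by rewrite /pincr pcoefS addrAC subrr add0r. Qed.

(** The entry 1 takes the increments of the coefficients of X^D to sums of
consecutive values, and the m twos and the factor 1 / k coming from the entry 3
complete y_k: this is the recursion [pincrS] for D + 1. The entry 3 itself and
the last twos repeat it with the sign moved, hence D + 2. *)
Lemma star_expansion_block D s : star_expansion s (pincr D) ->
  star_expansion (block m ++ s) (pincr D.+2).
Proof.
move=> sD; rewrite /block -!catA !cat_cons !cat0s.
(* Partial sums of the increments, shifted so that S 0 is the empty sum. *)
pose S k := if k is k'.+1 then pcoef D k' else 0.
have SE k : S k.+1 = S k + pincr D k.
  case: k => [|k] /=; first by rewrite add0r; case: (D) => //= ?; rewrite big_ord0.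
  by rewrite addrC subrK.
have s1 := star_expansion1 (erefl : S 0 = 0) SE sD.
have s2 := star_expansion_nseq2 m _ s1.
(* As (-1)^k / k^(2m+2) is - y_k, the sums in [star_expansion3] are those of the
increments for D + 1, up to a sign. *)
pose H k := if k is k'.+1 then - pcoef D.+1 k' else 0.
have HS k : H k.+1 = - pcoef D.+1 k by [].
have SS k : S k.+1 = pcoef D k by [].
have HE k : H k.+1 = H k + (-1) ^+ k * ((S k.+1 + S k) / k%:R / k%:R ^+ (2 * m) / k%:R).
  case: k => [|k]; first by rewrite /= big_ord0 invr0 mulr0 mulr0 addr0 oppr0.
  rewrite !HS !SS pcoefS opprD /yval exprD.
  have k0 : k.+1%:R != 0 :> R by rewrite pnatr_eq0.
  have kx : k.+1%:R ^+ (2 * m) != 0 :> R by rewrite expf_neq0.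
  move: (pcoef D k.+1 + pcoef D k) => p.
  move: (k.+1%:R ^+ (2 * m)) kx => q q0; move: k.+1%:R k0 => N N0.
  by move: ((-1) ^+ k.+1) => u; field; rewrite N0 q0.
have a0 : (S 1 + S 0) / 0%:R / 0%:R ^+ (2 * m) = 0 by rewrite invr0 mulr0 mul0r.
have s3 := star_expansion3 a0 (erefl : H 0 = 0) HE (s2 _).
have s4 := star_expansion_nseq2 m _ (s3 _).
apply: eq_star_expansion (s4 _ _) => [[|k]||].
- by rewrite /= expr0n /= invr0 mulr0 mul0r.
- rewrite !HS pincrS -opprD /yval exprD.
  have k0 : k.+1%:R != 0 :> R by rewrite pnatr_eq0.
  have kx : k.+1%:R ^+ (2 * m) != 0 :> R by rewrite expf_neq0.
  move: (pcoef D.+1 k.+1 + pcoef D.+1 k) => p.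
  move: (k.+1%:R ^+ (2 * m)) kx => q q0; move: k.+1%:R k0 => N N0.
  by move: ((-1) ^+ k.+1) => u; field; rewrite N0 q0.
- by rewrite expr0n /= invr0 mulr0.
- by rewrite invr0 mulr0.
Qed.

Lemma star_expansion_twos : star_expansion (nseq m.+1 2%N) (pincr 1).
Proof.
have h := star_expansion_nseq2 m.+1 (erefl : _ = 0) star_expansion_nil_alt.
rewrite cats0 in h; apply: eq_star_expansion h => -[|k]; first by rewrite mul0r.
rewrite pincrS /= /yval mulnS addnC mulNr [RHS]mulNr; congr (- _).
by rewrite -mulrA mulrC.
Qed.

Lemma star_expansion_blocks d D s : star_expansion s (pincr D) ->
  star_expansion (repeat_seq d (block m) ++ s) (pincr (2 * d + D)).
Proof.
move=> sD; elim: d => [|d IH]; first by rewrite muln0.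
rewrite mulnS -addnA /repeat_seq /= -catA; exact: star_expansion_block.
Qed.

Lemma star_expansion_pincr0 : star_expansion [::] (pincr 0).
Proof.
apply: eq_star_expansion star_expansion_nil => -[|k] //=; by rewrite subrr.
Qed.

End Blocks.

End StarSums.

(** * Passage to the limit *)

Section Limits.
Variable R : realType.

Lemma cbin_itv (n k : nat) : 0 <= cbin R n k <= 1.
Proof.
elim: k => [|k /andP[IH0 IH1]]; first by rewrite /= ler01 lexx.
have [kn|kn] := ltnP n k.+1; first by rewrite cbin_small // lexx ler01.
have N0 : 0 < (n + k).+1%:R :> R by rewrite ltr0n.
have d0 : 0 <= n%:R - k%:R :> R by rewrite subr_ge0 ler_nat ltnW.
have d1 : n%:R - k%:R <= (n + k).+1%:R :> R.
  rewrite (@le_trans _ _ n%:R) // ?lerBlDr ?lerDl ?ler0n // ler_nat.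
  by rewrite ltnW // ltnS leq_addr.
apply/andP; split; first by rewrite /= divr_ge0 ?mulr_ge0 // ltW.
by rewrite /= ler_pdivrMr // ler_pM.
Qed.

Lemma cbin_near1 (n k : nat) : 1 - cbin R n k <= k%:R ^+ 2 / n.+1%:R.
Proof.
elim: k => [|k IH]; first by rewrite subrr expr0n mul0r.
have /andP[c0 c1] := cbin_itv n k.
have N0 : 0 < n.+1%:R :> R by rewrite ltr0n.
have M0 : 0 < (n + k).+1%:R :> R by rewrite ltr0n.
have NM : n.+1%:R <= (n + k).+1%:R :> R by rewrite ler_nat ltnS leq_addr.
have -> : 1 - cbin R n k.+1 = (1 - cbin R n k)
    + cbin R n k * (2 * k%:R + 1) / (n + k).+1%:R.
  rewrite [cbin _ _ k.+1]/=.
  have -> : n%:R - k%:R = (n + k).+1%:R - (2 * k%:R + 1) :> R.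
    by rewrite -(natr1 (n + k)) natrD; ring.
  by field; rewrite gt_eqF.
have -> : k.+1%:R ^+ 2 / n.+1%:R =
    k%:R ^+ 2 / n.+1%:R + (2 * k%:R + 1) / n.+1%:R :> R.
  by rewrite -mulrDl -(natr1 k); congr (_ / _); ring.
apply: lerD => //.
have k0 : 0 <= 2 * k%:R + 1 :> R by rewrite addr_ge0 ?mulr_ge0 ?ler0n.
apply: (@le_trans _ _ ((2 * k%:R + 1) / (n + k).+1%:R)).
  by rewrite ler_pM2r ?invr_gt0 // ler_piMl.
by apply: ler_wpM2l => //; rewrite lef_pV2.
Qed.

Lemma sum_inv_sqr (K n : nat) : (0 < K)%N ->
  \sum_(K <= k < n) k.+1%:R ^- 2 <= K%:R^-1 :> R.
Proof.
move=> K0; have KR : 0 < K%:R :> R by rewrite ltr0n.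
have [nK|Kn] := leqP n K; first by rewrite big_geq // invr_ge0 ltW.
apply: (@le_trans _ _ (K%:R^-1 - n%:R^-1)); last by rewrite lerBlDr lerDl invr_ge0.
have -> : K%:R^-1 - n%:R^-1 = (- n%:R^-1) - (- K%:R^-1) :> R by rewrite opprK addrC.
rewrite -(@telescope_sumr _ K n (fun k : nat => - k%:R^-1)) ?(ltnW Kn) //.
apply: ler_sum_nat => k /andP[Kk _].
have k0 : 0 < k%:R :> R by rewrite ltr0n (leq_trans K0).
rewrite opprK -(natr1 k); move: k%:R k0 => x x0.
have x1 : 0 < x + 1 by rewrite addr_gt0.
have -> : - (x + 1)^-1 + x^-1 = (x * (x + 1))^-1 by field; rewrite !gt_eqF.
by rewrite lef_pV2 ?posrE ?mulr_gt0 ?exprn_gt0 // expr2 ler_pM2r // lerDl.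
Qed.

Lemma sum_inv_sqr_le2 n : \sum_(k < n) k.+1%:R ^- 2 <= 2 :> R.
Proof.
case: n => [|n]; first by rewrite big_ord0.
rewrite -(big_mkord xpredT (fun k => k.+1%:R ^- 2 : R)) big_ltn //.
rewrite expr1n invr1 -[2]/(1 + 1) lerD2l.
by apply: le_trans (@sum_inv_sqr 1 _ _) _; rewrite ?invr1.
Qed.

(** Dominated convergence: 1 - c(n, k) is at most k^2 / (n + 1), which serves for
k <= K, and at most 1, which serves for k > K. *)
Lemma cvg_cbin_sum (a : nat -> R) C : a 0 = 0 ->
  (forall k, `|a k.+1| <= C * k.+1%:R ^- 2) ->
  cbin_sum a n - \sum_(k < n) a k.+1 @[n --> \oo] --> (0 : R).
Proof.
move=> a0 aC.
have C0 : 0 <= C.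
  by have := le_trans (normr_ge0 _) (aC 0); rewrite expr1n invr1 mulr1.
have E n : cbin_sum a n - \sum_(k < n) a k.+1 =
    - \sum_(0 <= k < n) a k.+1 * (1 - cbin R n k.+1).
  rewrite /cbin_sum big_ord_recl a0 mul0r add0r big_mkord -sumrB -sumrN.
  by apply: eq_bigr => k _; rewrite lift0; ring.
have bound K n : (0 < K)%N -> (K <= n)%N ->
    `|cbin_sum a n - \sum_(k < n) a k.+1| <= K%:R * C / n.+1%:R + C / K%:R.
  move=> K0 Kn; rewrite E normrN; apply: le_trans (ler_norm_sum _ _ _) _.
  rewrite (big_cat_nat (n := K)) //; apply: lerD.
    apply: (@le_trans _ _ (\sum_(0 <= k < K) C / n.+1%:R)); last first.
      by rewrite big_mkord sumr_const card_ord -[_ *+ K]mulr_natl mulrA.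
    apply: ler_sum_nat => k _; have /andP[c0 c1] := cbin_itv n k.+1.
    rewrite normrM (ger0_norm (x := 1 - _)) ?subr_ge0 //.
    apply: (@le_trans _ _ (C * k.+1%:R ^- 2 * (k.+1%:R ^+ 2 / n.+1%:R))).
      by apply: ler_pM => //; rewrite ?subr_ge0 // cbin_near1.
    by rewrite mulrA divfK // expf_neq0 // pnatr_eq0.
  apply: (@le_trans _ _ (\sum_(K <= k < n) C * k.+1%:R ^- 2)); last first.
    by rewrite -mulr_sumr; apply: ler_wpM2l => //; exact: sum_inv_sqr.
  apply: ler_sum_nat => k _; have /andP[c0 c1] := cbin_itv n k.+1.
  rewrite normrM (ger0_norm (x := 1 - _)) ?subr_ge0 //.
  by apply: le_trans (aC k); rewrite ler_piMr // lerBlDr lerDl.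
apply/cvgr0Pnorm_le => e e0.
pose K := (Num.bound (2 * C / e)).+1.
have half x N : 0 <= x -> (Num.bound (2 * x / e) < N)%N -> x / N%:R <= e / 2.
  move=> x0 bN; have N0 : 0 < N%:R :> R by rewrite ltr0n (leq_ltn_trans _ bN).
  have : 2 * x / e < N%:R.
    apply: lt_le_trans (archi_boundP _) _; last by rewrite ler_nat ltnW.
    by rewrite divr_ge0 ?mulr_ge0 // ltW.
  by rewrite ltr_pdivrMr // ler_pdivrMr // => h; lra.
near=> n.
have Kn : (K <= n)%N by near: n; exact: nbhs_infty_ge.
have Nn : (Num.bound (2 * (K%:R * C) / e) <= n)%N by near: n; exact: nbhs_infty_ge.
apply: le_trans (bound K n _ Kn) _ => //.
rewrite [leRHS]splitr; apply: lerD; last exact: half.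
by apply: half; [exact: mulr_ge0|rewrite ltnS].
Unshelve. all: by end_near. Qed.

Variable m : nat.

Lemma norm_yval k : `|yval R m k.+1| <= k.+1%:R ^- 2.
Proof.
rewrite /yval normrN normrM normrX normrN1 expr1n mul1r normfV normrX normr_nat.
rewrite lef_pV2 ?posrE ?exprn_gt0 ?ltr0n //.
by rewrite ler_weXn2l ?ler1n // leq_addl.
Qed.

(** By induction on D, from sum_k |y_k| <= 2. *)
Lemma pincr_bound D : exists C : R,
  forall k, `|pincr R m D.+1 k.+1| <= C * k.+1%:R ^- 2.
Proof.
suff [C HC] : exists C : R, forall n, `|pcoef R m D n| <= C.
  exists (C + C) => k; rewrite pincrS normrM mulrC; apply: ler_pM => //.
    by apply: le_trans (ler_normD _ _) _; exact: lerD.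
  exact: norm_yval.
elim: D => [|D [C HC]]; first by exists 1 => n; rewrite normr1.
have C0 : 0 <= C by apply: le_trans (HC 0).
exists ((C + C) * 2) => n; rewrite [pcoef _ _ _ _]/=.
apply: le_trans (ler_norm_sum _ _ _) _.
apply: (@le_trans _ _ (\sum_(k < n) (C + C) * k.+1%:R ^- 2)); last first.
  by rewrite -mulr_sumr; apply: ler_wpM2l; [exact: addr_ge0|exact: sum_inv_sqr_le2].
apply: ler_sum => k _; rewrite normrM mulrC; apply: ler_pM => //.
  by apply: le_trans (ler_normD _ _) _; exact: lerD.
exact: norm_yval.
Qed.

Lemma pcoef_series D n : pcoef R m D.+1 n = \sum_(k < n) pincr R m D.+1 k.+1.
Proof. by apply: eq_bigr => k _; rewrite pincrS. Qed.

Lemma is_cvg_pcoef D : cvgn (pcoef R m D).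
Proof.
case: D => [|D]; first exact: is_cvg_cst.
have -> : pcoef R m D.+1 = series (fun k => pincr R m D.+1 k.+1).
  by apply/funext => n; rewrite pcoef_series /series /= big_mkord.
have [C HC] := pincr_bound D.
have C0 : 0 <= C.
  by have := le_trans (normr_ge0 _) (HC 0); rewrite expr1n invr1 mulr1.
apply: normed_cvg; apply: nondecreasing_is_cvgn.
  apply/nondecreasing_seqP => n.
  by rewrite /normed_series_of /series /= big_nat_recr //= lerDl.
exists (C * 2) => _ [n _ <-]; rewrite /normed_series_of /series /= big_mkord.
apply: (@le_trans _ _ (\sum_(k < n) C * k.+1%:R ^- 2)).
  by apply: ler_sum => k _; exact: HC.
by rewrite -mulr_sumr; apply: ler_wpM2l => //; exact: sum_inv_sqr_le2.
Qed.

Lemma cvg_star_expansion s D : star_expansion s (pincr R m D.+1) ->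
  zstar R s n @[n --> \oo] --> limn (pcoef R m D.+1).
Proof.
move=> sD; have [C HC] := pincr_bound D.
rewrite -cvg_shiftS.
have -> : (fun n => zstar R s n.+1) = (fun n =>
  (cbin_sum (pincr R m D.+1) n.+1 - \sum_(k < n.+1) pincr R m D.+1 k.+1)
    + pcoef R m D.+1 n.+1).
  by apply/funext => n; rewrite sD pcoef_series subrK.
have c1 := @cvg_cbin_sum (pincr R m D.+1) C erefl HC.
have c2 : pcoef R m D.+1 n @[n --> \oo] --> limn (pcoef R m D.+1).
  exact: is_cvg_pcoef.
rewrite -cvg_shiftS in c1; rewrite -cvg_shiftS in c2.
by have h := cvgD c1 c2; rewrite add0r in h; exact: h.
Qed.

End Limits.

(** * Star values as limits of truncated sums *)

Section StarValue.
Variable R : realType.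

Fixpoint dec_seqs (r n : nat) : seq (seq nat) :=
  if r is r'.+1 then [seq j.+1 :: t | j <- iota 0 n, t <- dec_seqs r' j.+1]
  else [:: [::]].

Lemma mem_dec_seqs r n t :
  (t \in dec_seqs r n) = [&& size t == r, path geq n t & all (leq 1) t].
Proof.
elim: r n t => [|r IH] n t; first by case: t.
apply/allpairsPdep/idP => [[j [u [jn]]]|].
  rewrite IH => /and3P[/eqP <- ju u1] -> /=.
  by rewrite eqxx ju u1 /= !andbT; move: jn; rewrite mem_iota.
case: t => [//|j u] /= /and3P[ru /andP[jn ju] /andP[j0 u1]].
exists j.-1, u; rewrite prednK // IH -eqSS ru ju u1; split=> //.
by rewrite mem_iota /= add0n prednK.
Qed.

Lemma uniq_dec_seqs r n : uniq (dec_seqs r n).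
Proof.
elim: r n => [//|r IH] n; apply: allpairs_uniq_dep; first exact: iota_uniq.
  by move=> j _; exact: IH.
by move=> [i t] [j u] _ _ /= [-> ->].
Qed.

Definition star_term (s t : seq nat) : R :=
  (\prod_(j < size s) (nth 0%N t j)%:R ^+ nth 0%N s j)^-1.

Lemma star_term_ge0 s t : 0 <= star_term s t.
Proof. by rewrite invr_ge0; apply: prodr_ge0 => j _; rewrite exprn_ge0. Qed.

Lemma zstarE s n : zstar R s n = \sum_(t <- dec_seqs (size s) n) star_term s t.
Proof.
elim: s n => [|a s IH] n.
  by rewrite /= big_seq1 /star_term big_ord0 invr1.
rewrite [LHS]/= [dec_seqs _ _]/= big_allpairs_dep /= -[n in RHS]subn0 big_mkord.
apply: eq_bigr => j _; rewrite IH mulr_suml; apply: eq_bigr => t _.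
by rewrite /star_term big_ord_recl /= invfM mulrC.
Qed.

Lemma zstar_ge0 s n : 0 <= zstar R s n.
Proof. by rewrite zstarE; apply: sumr_ge0 => t _; exact: star_term_ge0. Qed.

Lemma nondecreasing_zstar s : {homo zstar R s : n p / (n <= p)%N >-> n <= p}.
Proof.
apply/nondecreasing_seqP => n; case: s => [//|a s] /=.
by rewrite big_ord_recr /= lerDl divr_ge0 ?zstar_ge0 // exprn_ge0.
Qed.

Lemma mzsv_seq s : mzsv R s =
  \esum_(t in [set t : seq nat | [&& size t == size s, sorted geq t & all (leq 1) t]])
    (star_term s t)%:E.
Proof.
rewrite (@reindex_esum _ _ _ (@mzsv_index (size s)) _ (@tval (size s) nat)) /mzsv.
  apply: eq_esum => k _; congr (_^-1)%:E; apply: eq_bigr => j _.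
  by rewrite (tnth_nth 0%N).
split.
- by move=> k /= /andP[k1 k2]; rewrite size_tuple eqxx k1.
- by move=> k l _ _; exact: val_inj.
- by move=> t /= /and3P[ts t1 t2]; exists (Tuple ts) => //; apply/andP.
Qed.

(** Every finite set of indices is contained in one of the enumerated sets, which
are finite themselves; so the supremum of the finite sums is the limit. *)
Lemma mzsv_cvg s (L : R) : zstar R s n @[n --> \oo] --> L -> mzsv R s = L%:E.
Proof.
move=> zL; rewrite mzsv_seq; set S := [set t | _].
have zS n : (zstar R s n)%:E = (\sum_(t \in [set` dec_seqs (size s) n]) (star_term s t)%:E)%E.
  by rewrite -fsbig_seq ?uniq_dec_seqs // sumEFin zstarE.
have zle n : zstar R s n <= L.
  have <- : limn (zstar R s) = L by apply: cvg_lim.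
  by apply: nondecreasing_cvgn_le; [exact: nondecreasing_zstar|exact: cvgP zL].
apply/eqP; rewrite eq_le; apply/andP; split.
- apply: ge_ereal_sup => _ [A [/finite_seqP[r ->] rS] <-].
  pose n := \max_(t <- r) \max_(j <- t) j.
  apply: (@le_trans _ _ (zstar R s n)%:E); last by rewrite lee_fin.
  rewrite zS; apply: lee_fsum_nneg_subset; [exact: finite_seq|exact: finite_seq| |].
    move=> t; rewrite !inE => tr; have /= := rS _ tr.
    move=> /and3P[ts t1 t2]; rewrite mem_dec_seqs ts t2 andbT /=.
    have tn : (\max_(j <- t) j <= n)%N by exact: leq_bigmax_seq.
    case: t tn {tr ts} t1 t2 => //= x t tn -> _; rewrite andbT.
    by apply: leq_trans tn; apply: (@leq_bigmax_seq _ _ xpredT id); rewrite ?mem_head.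
  by move=> t _; rewrite lee_fin star_term_ge0.
- have zle2 n : ((zstar R s n)%:E <= \esum_(t in S) (star_term s t)%:E)%E.
    apply: esum_ge; exists [set` dec_seqs (size s) n]; last by rewrite zS.
    split; first exact: finite_seq.
    move=> t /=; rewrite mem_dec_seqs => /and3P[ts tp t1].
    by rewrite /S /= ts t1 (path_sorted tp).
  have zE : (zstar R s n)%:E @[n --> \oo] --> L%:E by apply: cvg_EFin => //; exact: nearW.
  rewrite -(cvg_lim _ zE) //; apply: lime_le; first exact: cvgP zE.
  exact: nearW.
Qed.

End StarValue.

(** * Separating even and odd k *)

Section ProductIdentity.
Variables (R : realType) (m : nat).

Definition star_fps n : fps R := Fps (fun D => pcoef R m D n).
Definition invpow (k : nat) : R := (k%:R ^- 2) ^+ m.+1.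

Local Notation u k := (1 - fpsC (invpow k) * fpsX).
Local Notation v k := (1 + fpsC (invpow k) * fpsX).

Lemma star_fps0 : star_fps 0 = 1.
Proof. by apply: fpsP => -[|D]; rewrite fcoef1 //= big_ord0. Qed.

Lemma star_fps_rec n :
  star_fps n.+1 * (1 - fpsC (yval R m n.+1) * fpsX) =
  star_fps n * (1 + fpsC (yval R m n.+1) * fpsX).
Proof.
apply: fpsP => D; rewrite mulrBr mulrDr !mulr1 !(mulrC (star_fps _)) -!mulrA.
rewrite fcoefB fcoefD !fcoefCM !fcoefXM; case: D => [|D].
  by rewrite /= mulr0 subr0 addr0.
by rewrite [X in X - _]/= -/(pcoef R m D.+1 n.+1) pcoefS; rewrite /=; ring.
Qed.

(** The sign prepares the substitution X = - t^(m+1). *)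
Definition star_fpsN n : fps R := scl (-1) (star_fps n).

Lemma yval_invpow k : yval R m k = - ((-1) ^+ k * invpow k).
Proof. by rewrite /yval /invpow exprVn -exprM mulnS addnC. Qed.

Lemma scl_binomial (c a : R) : scl c (1 + fpsC a * fpsX) = 1 + fpsC (c * a) * fpsX.
Proof. by rewrite rmorphD rmorph1 /= scl_monom. Qed.

Lemma star_fpsN_rec n : star_fpsN n.+1 * (1 + fpsC (yval R m n.+1) * fpsX) =
  star_fpsN n * (1 - fpsC (yval R m n.+1) * fpsX).
Proof.
have := congr1 (scl (-1)) (star_fps_rec n); rewrite !rmorphM /=.
have -> : 1 - fpsC (yval R m n.+1) * fpsX = 1 + fpsC (- yval R m n.+1) * fpsX :> fps R.
  by rewrite (fpsC_opp (yval R m n.+1)) mulNr.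
by rewrite !scl_binomial !mulN1r opprK.
Qed.

Lemma star_fpsN_odd n :
  star_fpsN (2 * n).+1 * v (2 * n).+1 = star_fpsN (2 * n) * u (2 * n).+1.
Proof.
have := star_fpsN_rec (2 * n); rewrite yval_invpow -signr_odd /= mul2n odd_double.
by rewrite mulN1r opprK.
Qed.

Lemma star_fpsN_even n :
  star_fpsN (2 * n).+2 * u (2 * n).+2 = star_fpsN (2 * n).+1 * v (2 * n).+2.
Proof.
have := star_fpsN_rec (2 * n).+1; rewrite yval_invpow -signr_odd /= negbK mul2n odd_double.
by rewrite mul1r fpsC_opp mulNr opprK.
Qed.

(** For odd k the factor is u_k / v_k and for even k it is v_k / u_k; the squares
correct the even k of the full products. *)
Lemma star_fpsN_prod n :
  star_fpsN (2 * n) * \prod_(k < 2 * n) v k.+1 * (\prod_(k < n) u (2 * k.+1)) ^+ 2 =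
  \prod_(k < 2 * n) u k.+1 * (\prod_(k < n) v (2 * k.+1)) ^+ 2.
Proof.
elim: n => [|n IH].
  by rewrite muln0 !big_ord0 /star_fpsN star_fps0 rmorph1 !mulr1.
rewrite mulnS !add2n !big_ord_recr /= mulnS !add2n.
have E1 := star_fpsN_odd n; have E2 := star_fpsN_even n.
move: IH E1 E2; set p := star_fpsN _; set p1 := star_fpsN _; set p2 := star_fpsN _.
set V := \prod_(i < 2 * n) _; set U := \prod_(i < n) _; set U' := \prod_(i < 2 * n) _.
set V' := \prod_(i < n) _.
set u1 := u (2 * n).+1; set v1 := v (2 * n).+1.
set u2 := u (2 * n).+2; set v2 := v (2 * n).+2 => IH E1 E2.
transitivity ((p2 * u2) * v1 * v2 * u2 * V * U ^+ 2); first by ring.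
rewrite E2; transitivity ((p1 * v1) * v2 * v2 * u2 * V * U ^+ 2); first by ring.
rewrite E1; transitivity ((p * V * U ^+ 2) * (u1 * u2 * v2 ^+ 2)); first by ring.
by rewrite IH; ring.
Qed.

End ProductIdentity.

(** * Coefficientwise convergence over the complex numbers *)

Section ComplexLimits.
Variable R : realType.
Local Notation C := R[i].

(** Stated on components, so that only limits of real sequences are used. *)
Definition ccvg (w : nat -> C) (l : C) : Prop :=
  complex.Re (w n) @[n --> \oo] --> complex.Re l /\
  complex.Im (w n) @[n --> \oo] --> complex.Im l.

Lemma ccvg_cst l : ccvg (fun=> l) l.
Proof. by split; exact: cvg_cst. Qed.

Lemma ccvg_real (w : nat -> R) (l : R) :
  w n @[n --> \oo] --> l -> ccvg (fun n => (w n)%:C) l%:C.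
Proof. by move=> wl; split => //=; exact: cvg_cst. Qed.

Lemma ccvgD w z a b : ccvg w a -> ccvg z b -> ccvg (fun n => w n + z n) (a + b).
Proof.
move=> [wa wa'] [zb zb']; split.
  under eq_fun do rewrite raddfD /=; rewrite raddfD /=; exact: cvgD.
under eq_fun do rewrite raddfD /=; rewrite raddfD /=; exact: cvgD.
Qed.

Lemma ccvgM w z a b : ccvg w a -> ccvg z b -> ccvg (fun n => w n * z n) (a * b).
Proof.
have ReM (x y : C) : complex.Re (x * y) = complex.Re x * complex.Re y - complex.Im x * complex.Im y.
  by case: x y => [? ?] [? ?].
have ImM (x y : C) : complex.Im (x * y) = complex.Re x * complex.Im y + complex.Im x * complex.Re y.
  by case: x y => [? ?] [? ?].
move=> [wa wa'] [zb zb']; split.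
  under eq_fun do rewrite ReM; rewrite ReM; apply: cvgB; exact: cvgM.
under eq_fun do rewrite ImM; rewrite ImM; apply: cvgD; exact: cvgM.
Qed.

Lemma ccvg_unique w a b : ccvg w a -> ccvg w b -> a = b.
Proof.
move=> [wa wa'] [wb wb']; apply/eqP; rewrite eq_complex.
by rewrite (cvg_unique _ wa wb) // (cvg_unique _ wa' wb') // !eqxx.
Qed.

Definition fcvg (F : nat -> fps C) (f : fps C) : Prop :=
  forall l, ccvg (fun n => (F n).%[l]) f.%[l].

Lemma fcvgM F G f g : fcvg F f -> fcvg G g -> fcvg (fun n => F n * G n) (f * g).
Proof.
move=> Ff Gg l; rewrite fcoefM; under eq_fun do rewrite fcoefM.
move: l.+1 (fun i : nat => l - i)%N => k h.
elim: k => [|k IH].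
  by rewrite big_ord0; under eq_fun do rewrite big_ord0; exact: ccvg_cst.
rewrite big_ord_recr; under eq_fun do rewrite big_ord_recr.
by apply: ccvgD => //; exact: ccvgM.
Qed.

Lemma fcvg_prod k (F : 'I_k -> nat -> fps C) (f : 'I_k -> fps C) :
  (forall i, fcvg (F i) (f i)) -> fcvg (fun n => \prod_i F i n) (\prod_i f i).
Proof.
elim: k F f => [|k IH] F f Ff.
  by rewrite big_ord0; under eq_fun do rewrite big_ord0; move=> l; exact: ccvg_cst.
rewrite big_ord_recr; under eq_fun do rewrite big_ord_recr.
by apply: fcvgM => //; exact: IH.
Qed.

Lemma fcvg_scl c F f : fcvg F f -> fcvg (fun n => scl c (F n)) (scl c f).
Proof. by move=> Ff l; apply: ccvgM; [exact: ccvg_cst|exact: Ff]. Qed.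

Lemma fcvg_unique F f g : fcvg F f -> fcvg F g -> f = g.
Proof. by move=> Ff Fg; apply: fpsP => l; exact: ccvg_unique (Ff l) (Fg l). Qed.

End ComplexLimits.

(** * Roots of unity *)

Section RootsOfUnity.
Variable R : realType.
Local Notation C := R[i].

Definition cis (x : R) : C := cos x +i* sin x.

Lemma cisD x y : cis (x + y) = cis x * cis y.
Proof. by rewrite /cis cosD sinD; simpc; rewrite addrC; congr (_ +i* _); rewrite addrC. Qed.

Lemma cisX x n : cis x ^+ n = cis (x * n%:R).
Proof.
elim: n => [|n IH]; first by rewrite mulr0 /cis cos0 sin0.
by rewrite exprS IH -natr1 mulrDr mulr1 addrC cisD.
Qed.

Lemma cexp_imag (x : R) : cexp (0 +i* x) = cis x.
Proof. by rewrite /cexp /= expR0 mul1r. Qed.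

Variable m : nat.

Definition zeta : C := cis (pi / m.+1%:R).
Definition omega : C := cis (2 * pi / m.+1%:R).

Lemma cexp_zeta l : cexp (pi%:C * 'i * l%:R / m.+1%:R) = zeta ^+ l.
Proof.
rewrite /zeta cisX -cexp_imag; congr cexp.
have natC n : n%:R = (n%:R : R)%:C by rewrite rmorph_nat.
rewrite !natC -fmorphV /= -complexiE; simpc.
by rewrite mulrAC.
Qed.

Lemma zetaX : zeta ^+ m.+1 = -1.
Proof.
rewrite cisX divfK ?pnatr_eq0 // /cis cospi sinpi.
by apply/eqP; rewrite eq_complex /= oppr0 !eqxx.
Qed.

Lemma omega_prim : m.+1.-primitive_root omega.
Proof.
have omegaX : omega ^+ m.+1 = 1.
  rewrite cisX divfK ?pnatr_eq0 // /cis mulr_natl cos2pi sin2pi. by [].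
have [k kprim km] := prim_order_exists (ltn0Sn m) omegaX.
have [<-//|km1] := eqVneq k m.+1.
have k0 := prim_order_gt0 kprim; have := prim_expr_order kprim.
have klt : (k < m.+1)%N by rewrite ltn_neqAle km1 dvdn_leq.
rewrite cisX => /eqP; rewrite eq_complex /= => /andP[/eqP ck _].
set x := pi * (k%:R / m.+1%:R) : R.
have xE : 2 * pi / m.+1%:R * k%:R = x *+ 2 by rewrite /x -mulr_natl; ring.
have x0 : 0 < x by rewrite mulr_gt0 ?pi_gt0 // divr_gt0 ?ltr0n.
have xpi : x < pi.
  by rewrite /x gtr_pMr ?pi_gt0 // ltr_pdivrMr ?ltr0n // mul1r ltr_nat.
have := sin_gt0_pi (x := x); rewrite x0 xpi => /(_ isT).
move: ck; rewrite xE mulr2n cosD -!expr2 cos2sin2 => ck s0.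
have : 0 < sin x ^+ 2 by rewrite exprn_gt0.
lra.
Qed.

Lemma cexp_omega e : cexp (2%:R * pi%:C * 'i / m.+1%:R * e%:R) = omega ^+ e.
Proof.
rewrite /omega cisX -cexp_imag; congr cexp.
have natC n : n%:R = (n%:R : R)%:C by rewrite rmorph_nat.
by rewrite !natC -fmorphV /= -complexiE; simpc.
Qed.

Lemma poly_factor_scale (F : fieldType) (a : F) : a != 0 ->
  1 - a *: 'X = - a *: ('X - (a^-1)%:P).
Proof.
by move=> a0; rewrite scalerBr scale_polyC mulNr divff // polyCN opprK scaleNr addrC.
Qed.

(** The inverse of omega is primitive too, so this is the factorisation of
X^(m+1) - 1 up to a scalar, which is found at X = 0. *)
Lemma prod_poly_omega :
  \prod_(j < m.+1) (1 - (omega ^+ j) *: 'X) = 1 - 'X^(m.+1) :> {poly C}.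
Proof.
have o0 : omega != 0.
  by apply: contra_eq_neq (prim_expr_order omega_prim) => ->; rewrite expr0n eq_sym oner_eq0.
have oV : omega ^+ m = omega^-1.
  by apply: (mulfI o0); rewrite -exprS (prim_expr_order omega_prim) divff.
have zprim : m.+1.-primitive_root omega^-1.
  have := exp_prim_root omega_prim m.
  by rewrite oV (eqP (coprimenS m)) divn1.
have E := factor_Xn_sub_1 zprim; rewrite big_mkord in E.
pose c := \prod_(j < m.+1) (- omega ^+ j).
have H : \prod_(j < m.+1) (1 - (omega ^+ j) *: 'X) = c *: ('X^(m.+1) - 1) :> {poly C}.
  rewrite -E /c -scaler_prod; apply: eq_bigr => j _.
  by rewrite exprVn; apply: poly_factor_scale; rewrite expf_neq0.
have c1 : c = -1.
  have := congr1 (fun p => p.[0]) H; rewrite /= horner_prod big1; last first.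
    move=> j _. by rewrite hornerD hornerN hornerZ hornerX hornerC mulr0 subr0.
  by rewrite !hornerE expr0n /= sub0r mulrN1 => ->; rewrite opprK.
by rewrite H c1 scaleN1r opprB.
Qed.

Definition fps_of_poly (p : {poly C}) : fps C := Fps (fun i => p`_i).

Lemma fps_of_polyM p q : fps_of_poly (p * q) = fps_of_poly p * fps_of_poly q.
Proof. by apply: fpsP => n; exact: coefM_agree. Qed.

Lemma fps_of_poly1 : fps_of_poly 1 = 1.
Proof. by apply: fpsP => n; rewrite /= coef1. Qed.

Lemma scl_dil (c : C) f : scl c (dil m f) = dil m (scl (c ^+ m.+1) f).
Proof.
apply: fpsP => n /=; case: ifP => [/dvdnP[k ->]|_]; last by rewrite mulr0.
by rewrite mulnK // -exprM mulnC.
Qed.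

Lemma fps_of_poly_binomial : fps_of_poly (1 - 'X^(m.+1)) = dil m (1 - fpsX).
Proof.
apply: fpsP => n; rewrite /= coefB coef1 coefXn.
case: (boolP (m.+1 %| n)%N) => [/dvdnP[k ->]|kn].
  rewrite mulnK // muln_eq0 orbF; congr (_ - _%:R).
  by rewrite -{2}[m.+1]mul1n eqn_pmul2r.
case: eqP kn => [->|_]; first by rewrite dvdn0.
by case: eqP => [->|_ _]; rewrite ?dvdnn // subrr.
Qed.


Lemma prod_scl_omega (c : C) :
  \prod_(j < m.+1) scl (omega ^+ j) (1 - fpsC c * fpsX) =
  dil m (1 - fpsC (c ^+ m.+1) * fpsX).
Proof.
have sc (a : C) : 1 - fpsC a * fpsX = scl a (1 - fpsX).
  by rewrite rmorphB rmorph1 /= sclX.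
transitivity (scl c (\prod_(j < m.+1) scl (omega ^+ j) (1 - fpsX))).
  by rewrite rmorph_prod; apply: eq_bigr => j _; rewrite sc /= !scl_scl mulrC.
have -> : \prod_(j < m.+1) scl (omega ^+ j) (1 - fpsX) =
    fps_of_poly (\prod_(j < m.+1) (1 - (omega ^+ j) *: 'X)).
  rewrite (big_morph _ fps_of_polyM fps_of_poly1); apply: eq_bigr => j _.
  rewrite -sc; apply: fpsP => n.
  by rewrite fcoefB fcoef1 fcoefCM /= coefB coef1 coefZ coefX.
by rewrite prod_poly_omega fps_of_poly_binomial scl_dil sc.
Qed.

End RootsOfUnity.

(** * The generating function as a product of quotients of sines *)

Section GeneratingFunction.
Variables (R : realType) (m : nat).
Local Notation C := R[i].
Local Notation mapC := (fps_map (real_complex R)).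
Local Notation om := (omega R m).
Local Notation ze := (zeta R m).

(** The norm of a series from C[[X]] to C[[X^(m+1)]]. *)
Definition rot_prod (f : fps C) : fps C := \prod_(j < m.+1) scl (om ^+ j) f.

Lemma rot_prodM f g : rot_prod (f * g) = rot_prod f * rot_prod g.
Proof. by rewrite /rot_prod -big_split; apply: eq_bigr => j _; rewrite rmorphM. Qed.

Lemma rot_prodX f n : rot_prod (f ^+ n) = rot_prod f ^+ n.
Proof. by rewrite /rot_prod -prodrXl; apply: eq_bigr => j _; rewrite rmorphXn. Qed.

Lemma fcvg_rot_prod F f : fcvg F f -> fcvg (fun n => rot_prod (F n)) (rot_prod f).
Proof. by move=> Ff; apply: fcvg_prod => j; exact: fcvg_scl. Qed.

Lemma rot_prod_sin (c : C) n :
  rot_prod (scl c (mapC (sin_prod R n))) =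
  \prod_(k < n) dil m (1 - fpsC ((c * (k.+1%:R ^- 2 : R)%:C) ^+ m.+1) * fpsX).
Proof.
have E : scl c (mapC (sin_prod R n)) =
    \prod_(k < n) (1 - fpsC (c * (k.+1%:R ^- 2 : R)%:C) * fpsX).
  rewrite /sin_prod !rmorph_prod; apply: eq_bigr => k _ /=.
  rewrite rmorphB rmorph1 /= fps_map_monom.
  by rewrite rmorphB rmorph1 /= scl_monom.
rewrite E /rot_prod; under eq_bigr do rewrite rmorph_prod.
by rewrite exchange_big; apply: eq_bigr => k _; exact: prod_scl_omega.
Qed.

Local Notation V n := (rot_prod (scl ze (mapC (sin_prod R n)))).
Local Notation U n := (rot_prod (scl 1 (mapC (sin_prod R n)))).
Local Notation V4 n := (rot_prod (scl (ze * 4^-1) (mapC (sin_prod R n)))).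
Local Notation U4 n := (rot_prod (scl 4^-1 (mapC (sin_prod R n)))).

(** The powers (m+1) of c / k^2 are + or - the (m+1)-th power of 1 / k^2 for c = 1
and c = zeta, and c / 4 replaces k by 2k: the four products are the norms of
those in [star_fpsN_prod]. *)
Lemma rot_star_fps n :
  dil m (mapC (star_fpsN R m (2 * n))) * V (2 * n) * U4 n ^+ 2 =
  U (2 * n) * V4 n ^+ 2.
Proof.
have uE a : dil m (mapC (1 - fpsC a * fpsX)) = dil m (1 - fpsC a%:C * fpsX).
  by rewrite rmorphB rmorph1 /= fps_map_monom.
have vE a : dil m (mapC (1 + fpsC a * fpsX)) = dil m (1 + fpsC a%:C * fpsX).
  by rewrite rmorphD rmorph1 /= fps_map_monom.
pose phi (f : fps R) := dil m (mapC f).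
have phi_eq (a b c d e : fps R) : a * b * c ^+ 2 = d * e ^+ 2 ->
    phi a * phi b * phi c ^+ 2 = phi d * phi e ^+ 2.
  by move=> E; rewrite /phi -!rmorphXn -!rmorphM E !rmorphM.
have zeM (x : C) : (ze * x) ^+ m.+1 = - x ^+ m.+1.
  by rewrite exprMn zetaX mulN1r.
have inv1 k : (k%:R ^- 2 : R)%:C ^+ m.+1 = (invpow R m k)%:C by rewrite -rmorphXn.
have inv4 k : (4^-1 * (k%:R ^- 2 : R)%:C) ^+ m.+1 = (invpow R m (2 * k))%:C.
  rewrite /invpow [RHS]rmorphXn; congr (_ ^+ _).
  have -> : (2 * k)%:R ^- 2 = 4^-1 * k%:R ^- 2 :> R by rewrite natrM exprMn -(natrX _ 2 2) invfM.
  by rewrite [RHS]rmorphM; congr (_ * _); rewrite [RHS]fmorphV rmorph_nat.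
have h := phi_eq _ _ _ _ _ (star_fpsN_prod R m n).
have -> : V (2 * n) = phi (\prod_(k < 2 * n) (1 + fpsC (invpow R m k.+1) * fpsX)).
  rewrite rot_prod_sin /phi !rmorph_prod; apply: eq_bigr => k _ /=.
  by rewrite vE zeM inv1 fpsC_opp mulNr opprK.
have -> : U (2 * n) = phi (\prod_(k < 2 * n) (1 - fpsC (invpow R m k.+1) * fpsX)).
  rewrite rot_prod_sin /phi !rmorph_prod; apply: eq_bigr => k _ /=.
  by rewrite uE mul1r inv1.
have -> : U4 n = phi (\prod_(k < n) (1 - fpsC (invpow R m (2 * k.+1)) * fpsX)).
  rewrite rot_prod_sin /phi !rmorph_prod; apply: eq_bigr => k _ /=.
  by rewrite uE inv4.
have -> : V4 n = phi (\prod_(k < n) (1 + fpsC (invpow R m (2 * k.+1)) * fpsX)).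
  rewrite rot_prod_sin /phi !rmorph_prod; apply: eq_bigr => k _ /=.
  by rewrite vE -mulrA zeM inv4 fpsC_opp mulNr opprK.
exact: h.
Qed.

Lemma cvg_double (w : nat -> R) (l : R) :
  w n @[n --> \oo] --> l -> w (2 * n)%N @[n --> \oo] --> l.
Proof.
move=> wl; apply: cvg_comp wl => A [N _ NA]; exists N => // n /= Nn.
by apply: NA; rewrite /= (leq_trans Nn) // leq_pmull.
Qed.

Lemma fcvg_map (F : nat -> fps R) f :
  (forall l, (F n).%[l] @[n --> \oo] --> f.%[l]) ->
  fcvg (fun n => mapC (F n)) (mapC f).
Proof. by move=> Ff l; exact: ccvg_real. Qed.

Definition sin_fps : fps C := mapC (scl (- pi ^+ 2) (sinhc R)).

Lemma fcvg_sin_prod : fcvg (fun n => mapC (sin_prod R n)) sin_fps.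
Proof. by apply: fcvg_map => l; exact: cvg_sin_prod. Qed.

Lemma fcvg_sin_prod2 : fcvg (fun n => mapC (sin_prod R (2 * n))) sin_fps.
Proof.
apply: fcvg_map => l; apply: (@cvg_double (fun n => (sin_prod R n).%[l])).
exact: cvg_sin_prod.
Qed.

(** Stated for arbitrary sequences, to pass to the limit in [rot_star_fps] without
unfolding the products. *)
Lemma fcvg_eq (F G H K L : nat -> fps C) f g h k l :
  (forall n, F n * G n * H n ^+ 2 = K n * L n ^+ 2) ->
  fcvg F f -> fcvg G g -> fcvg H h -> fcvg K k -> fcvg L l ->
  f * g * h ^+ 2 = k * l ^+ 2.
Proof.
move=> E Ff Gg Hh Kk Ll.
have := fcvgM (fcvgM Ff Gg) (fcvgM Hh Hh).
have -> : (fun n => F n * G n * (H n * H n)) = (fun n => K n * (L n * L n)).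
  by apply/funext => n; exact: E.
move=> lhs; exact: (fcvg_unique lhs (fcvgM Kk (fcvgM Ll Ll))).
Qed.

Definition star_limit : fps R := Fps (fun D => limn (pcoef R m D)).

Lemma star_limit_rot :
  dil m (mapC (scl (-1) star_limit)) * rot_prod (scl ze sin_fps)
    * rot_prod (scl 4^-1 sin_fps) ^+ 2 =
  rot_prod (scl 1 sin_fps) * rot_prod (scl (ze * 4^-1) sin_fps) ^+ 2.
Proof.
have cl : fcvg (fun n => dil m (mapC (star_fpsN R m (2 * n))))
               (dil m (mapC (scl (-1) star_limit))).
  move=> l; rewrite /=; case: ifP => [_|_]; last exact: ccvg_cst.
  apply: ccvg_real; apply: cvgMl_tmp; apply: (@cvg_double (pcoef R m _)); exact: is_cvg_pcoef.
have cr c F : fcvg F sin_fps -> fcvg (fun n => rot_prod (scl c (F n))) (rot_prod (scl c sin_fps)).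
  by move=> FS; apply: fcvg_rot_prod; exact: fcvg_scl.
exact: (fcvg_eq rot_star_fps cl (cr ze _ fcvg_sin_prod2) (cr 4^-1 _ fcvg_sin_prod)
  (cr 1 _ fcvg_sin_prod2) (cr (ze * 4^-1) _ fcvg_sin_prod)).
Qed.

End GeneratingFunction.

(** * Comparison of coefficients *)

Section Coefficients.
Variables (R : realType) (m : nat) (B : nat -> R).
Hypothesis hB : is_bernoulli B.
Local Notation C := R[i].
Local Notation mapC := (fps_map (real_complex R)).
Local Notation ze := (zeta R m).

(** With the variable multiplied by - pi^2, the hyperbolic functions become
x cot x and tan x / x at x = pi sqrt t / 2. *)
Definition coth_fps : fps C := mapC (scl (- pi ^+ 2) (bern_even B)).
Definition tanh_fps : fps C := mapC (scl (- pi ^+ 2) (bern_tanh B)).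

Lemma scl_mapC (c : R) f : mapC (scl c f) = scl c%:C (mapC f).
Proof. by apply: fpsP => n /=; rewrite rmorphM rmorphXn. Qed.

Lemma sin_fps4 : scl 4^-1 (sin_fps R) = mapC (scl (- pi ^+ 2) (scl 4^-1 (sinhc R))).
Proof.
rewrite /sin_fps !scl_mapC !scl_scl mulrC; congr (scl (_ * _) _).
by rewrite fmorphV rmorph_nat.
Qed.

Lemma sin_coth : sin_fps R = scl 4^-1 (sin_fps R) ^+ 2 * coth_fps.
Proof.
rewrite sin_fps4 /sin_fps {1}(sinhc_bern_even (bernoulli_mul_expR1 hB)).
by rewrite 2!rmorphM !rmorphXn.
Qed.

Lemma sin_tanh : scl 4^-1 (sin_fps R) ^+ 2 = sin_fps R * tanh_fps.
Proof.
rewrite sin_fps4.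
have := congr1 (fun f => mapC (scl (- pi ^+ 2) f)) (sinhc_bern_tanh (bernoulli_mul_expR1 hB)).
by rewrite /= [scl 4^-1 (sinhc R) ^+ 2]expr2 !rmorphM /=.
Qed.

Lemma rot_prod_coef0 (f : fps C) : f.%[0] = 1 -> (rot_prod m f).%[0] = 1.
Proof.
by move=> f0; rewrite fcoef_prod0 big1 // => j _; rewrite /= mul1r f0.
Qed.

Lemma fps_cancel2 (L a b U V F T : fps C) : a.%[0] = 1 -> b.%[0] = 1 ->
  L * a * b = U * V -> U = b * F -> V = a * T -> L = T * F.
Proof.
move=> a0 b0 E EU EV; apply: (fps_mulI a0); apply: (fps_mulI b0).
transitivity (L * a * b); first by ring.
by rewrite E EU EV; ring.
Qed.

(** The quotients of sines are regrouped into a cotangent for each omega^j t and a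
tangent for each zeta omega^j t. *)
Lemma star_limitE : dil m (mapC (scl (-1) (star_limit R m))) =
  rot_prod m (scl ze tanh_fps * coth_fps).
Proof.
have s0 : (sin_fps R).%[0] = 1 by rewrite /= expr0 mul1r invr1.
have scl0 c (f : fps C) : (scl c f).%[0] = f.%[0] by rewrite /= mul1r.
have a0 : (rot_prod m (scl ze (sin_fps R))).%[0] = 1.
  by apply: rot_prod_coef0; rewrite scl0 s0.
have b0 : (rot_prod m (scl 4^-1 (sin_fps R)) ^+ 2).%[0] = 1.
  rewrite -rot_prodX; apply: rot_prod_coef0.
  by rewrite expr2 fcoefM big_ord1 scl0 s0 mulr1.
rewrite rot_prodM; apply: (fps_cancel2 a0 b0 (star_limit_rot R m)).
- have -> : scl 1 (sin_fps R) = sin_fps R.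
    by apply: fpsP => n /=; rewrite expr1n mul1r.
  by rewrite {1}sin_coth rot_prodM rot_prodX.
- by rewrite -scl_scl -rot_prodX -rot_prodM -rmorphXn sin_tanh rmorphM.
Qed.

Lemma tanh_coth_coef n : (scl ze tanh_fps * coth_fps).%[n] =
  (- pi ^+ 2)%:C ^+ n * 4 * bernoulli_factor B m n.
Proof.
rewrite fcoefM /bernoulli_factor mulr_sumr; apply: eq_bigr => l _.
have ln : (l <= n)%N by rewrite -ltnS.
have -> : (- pi ^+ 2)%:C ^+ n = (- pi ^+ 2)%:C ^+ l * (- pi ^+ 2)%:C ^+ (n - l) :> C.
  by rewrite -exprD subnKC.
rewrite cexp_zeta /= !(rmorphM, rmorphXn) /= -mulnBr (rmorph_nat _ 4).
by ring.
Qed.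

(** The exponents e_0, ..., e_m of a term of degree (m+1) D of [rot_prod] are the
n_k of the Bernoulli sum, and omega^(k n_k) comes from the k-th rotation. *)
Lemma star_limit_coef D : (-1) ^+ D * (star_limit R m).%[D]%:C =
  (-1) ^+ (D * m.+1) * 4 ^+ m.+1 * pi%:C ^+ (2 * (D * m.+1))
  * bernoulli_sum B m (D * m.+1).
Proof.
have := congr1 (fun f => f.%[D * m.+1]) star_limitE.
rewrite [X in X = _ -> _]dil_coef [X in X = _ -> _]/= rmorphM rmorphXn rmorphN1 => ->.
rewrite /rot_prod fcoef_prod /bernoulli_sum mulr_sumr; apply: eq_bigr => e /eqP eN.
rewrite cexp_omega.
transitivity (\prod_(k < m.+1) (omega R m ^+ (k * e k) *
    ((- pi ^+ 2)%:C ^+ e k * 4 * bernoulli_factor B m (e k)))).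
  by apply: eq_bigr => k _; rewrite exprM -tanh_coth_coef.
rewrite big_split /= prodrXr big_split /= big_split /= prodrXr eN prodr_const card_ord.
have -> : (- pi ^+ 2)%:C = - pi%:C ^+ 2 :> C by rewrite rmorphN rmorphXn.
have -> N : (- pi%:C ^+ 2) ^+ N = (-1) ^+ N * pi%:C ^+ (2 * N) :> C.
  by rewrite (exprNn (pi%:C ^+ 2)) exprM.
by ring.
Qed.

End Coefficients.

Theorem theorem1p3 (R : realType) (B : nat -> R) (hB : is_bernoulli B)
    (d m : nat) (hd : (0 < d)%N) :
  (mzsv R (repeat_seq d (block m)) \is a fin_num /\
   (fine (mzsv R (repeat_seq d (block m))))%:C =
     4%:R ^+ m.+1 * pi%:C ^+ (4 * d * (m + 1))%N
     * bernoulli_sum B m (2 * (m + 1) * d)%N) /\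
  (mzsv R (repeat_seq d (block m) ++ nseq m.+1 2%N) \is a fin_num /\
   (fine (mzsv R (repeat_seq d (block m) ++ nseq m.+1 2%N)))%:C =
     (-1) ^+ m * 4%:R ^+ m.+1 * pi%:C ^+ ((4 * d + 2) * (m + 1))%N
     * bernoulli_sum B m ((m + 1) * (2 * d + 1))%N).
Proof.
have val s D : star_expansion s (pincr R m D.+1) ->
    mzsv R s = ((star_limit R m).%[D.+1])%:E.
  by move=> sD; apply: mzsv_cvg; exact: cvg_star_expansion sD.
have v0 : mzsv R (repeat_seq d (block m)) = ((star_limit R m).%[2 * d])%:E.
  have := star_expansion_blocks d (star_expansion_pincr0 R m).
  rewrite cats0 addn0 -[(2 * d)%N]prednK ?muln_gt0 //; exact: val.
have v1 : mzsv R (repeat_seq d (block m) ++ nseq m.+1 2%N) =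
    ((star_limit R m).%[(2 * d).+1])%:E.
  have := star_expansion_blocks d (star_expansion_twos R m).
  by rewrite addn1; exact: val.
rewrite v0 v1; split; split=> //; rewrite [fine _]/=.
  have := star_limit_coef m hB (2 * d).
  have -> : (2 * d * m.+1 = 2 * (m + 1) * d)%N by ring.
  have -> : (2 * (2 * (m + 1) * d) = 4 * d * (m + 1))%N by ring.
  have -> : (-1) ^+ (2 * d) = 1 :> R[i] by rewrite exprM sqrrN !expr1n.
  have -> : (-1) ^+ (2 * (m + 1) * d) = 1 :> R[i].
    by rewrite -mulnA exprM sqrrN !expr1n.
  by rewrite !mul1r.
have := star_limit_coef m hB (2 * d).+1.
have -> : (-1) ^+ ((2 * d).+1 * m.+1) = - (-1) ^+ m :> R[i].
  by rewrite mulSn exprD -mulnA exprM sqrrN !expr1n mulr1 exprS mulN1r.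
have -> : (-1) ^+ (2 * d).+1 = -1 :> R[i] by rewrite exprS exprM sqrrN !expr1n mulr1.
have -> : ((2 * d).+1 * m.+1 = (m + 1) * (2 * d + 1))%N by ring.
have -> : (2 * ((m + 1) * (2 * d + 1)) = (4 * d + 2) * (m + 1))%N by ring.
by rewrite mulN1r !mulNr => /oppr_inj.
Qed.
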